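(* Let $G$ be a connected Lie group acting properly on $E=\mathbb{R}^d$, $d\ge2$, and consider the diagonal action $S_g(r_1,\dots,r_N)=(g r_1,\dots,g r_N)$ of $G$ on $E^N$. Assume that the Lagrangian $L$ of the Newtonian $N$-body problem is $G$-invariant, i.e. $L(S_g x, T_xS_g v)=L(x,v)$ for all $g\in G$ and $x,v\in E^N$, and that the lifted action $g(x,v)=(S_gx,T_xS_gv)$ on $E^N\times E^N$ is by isometries of the mass inner product. Let $\mu:E^N\times E^N\to\mathfrak{g}^*$ be the associated equivariant momentum map, and let $u:E^N\to\mathbb{R}$ be a weak KAM solution of the Hamilton--Jacobi equation $\|Du(x)\|_*^2=2U(x)$. Then $u$ is $G$-invariant (i.e. $u(S_gx)=u(x)$ for all $g\in G$ and $x\in E^N$) if and only if for every curve $\gamma:[0,+\infty)\to E^N$ that calibrates $u$ and every $t>0$ one has $\mu(\gamma(t),\dot\gamma(t))=0$.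
   Context: Let $d\ge 2$, $E=\mathbb{R}^d$ with Euclidean inner product $\langle\cdot,\cdot\rangle$ and norm $|\cdot|$, and let $m_1,\dots,m_N>0$ be masses. For $x=(r_1,\dots,r_N)\in E^N$ the Newtonian potential is $U(x)=\sum_{i<j} \frac{m_i m_j}{|r_i-r_j|}\in(0,+\infty]$ (equal to $+\infty$ when $r_i=r_j$ for some $i\ne j$). The mass inner product on $E^N$ is $x\cdot y=\sum_{i=1}^N m_i\langle r_i,s_i\rangle$ for $x=(r_i)$, $y=(s_i)$, with norm $\|\cdot\|$. The Lagrangian is $L(x,v)=\frac12\|v\|^2+U(x)$ and the action of an absolutely continuous curve $\gamma:[a,b]\to E^N$ is $A(\gamma)=\int_a^b L(\gamma(t),\dot\gamma(t))\,dt$. The Mañé critical action potential is $\phi(x,y)=\inf A(\gamma)$, the infimum being over all absolutely continuous curves $\gamma:[a,b]\to E^N$ with $\gamma(a)=x$, $\gamma(b)=y$ and arbitrary $b-a>0$. A weak KAM solution of the Hamilton--Jacobi equation $\|Du(x)\|_*^2=2U(x)$ (where $\|p\|_*^2=\sum_i m_i^{-1}|p_i|^2$) is, by definition, a function $u:E^N\to\mathbb{R}$ such that: (i) $u$ is dominated, i.e. $u(y)-u(x)\le\phi(x,y)$ for all $x,y\in E^N$; (ii) for every $x\in E^N$ there is an absolutely continuous curve $\alpha:[0,\infty)\to E^N$ with $\alpha(0)=x$ that calibrates $u$. An absolutely continuous curve $\alpha:[0,\infty)\to E^N$ calibrates $u$ if $u(\alpha(0))-u(\alpha(t))=A(\alpha|_{[0,t]})$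 for every $t>0$. (Calibrating curves of a weak KAM solution minimize the action, and by Marchal's theorem minimizers have no collisions in the interior of their interval of definition; hence they are smooth solutions of Newton's equations for $t>0$ and $\dot\gamma(t)$ is defined for all $t>0$.) $\mathfrak{g}$ is the Lie algebra of $G$, $[\cdot,\cdot]$ denotes the pairing between $\mathfrak{g}^*$ and $\mathfrak{g}$, and $T_xS_g$ is the differential of $S_g$ at $x$. The equivariant momentum map $\mu:E^N\times E^N\to\mathfrak{g}^*$ is defined by $[\mu(x,v),\xi]=v\cdot X_\xi(x)$ for all $\xi\in\mathfrak{g}$, where $X_\xi(x)=\frac{d}{dt}\big|_{t=0}S_{\exp(t\xi)}x$ is the infinitesimal generator of the one-parameter subgroup action on $E^N$ associated to $\xi$. *)

(* Defs.v *)
From HB Require Import structures.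
From mathcomp Require Import all_boot all_order all_algebra.
From mathcomp Require Import all_classical all_reals all_analysis.

Set Implicit Arguments.
Unset Strict Implicit.
Unset Printing Implicit Defensive.

Import Order.TTheory GRing.Theory Num.Theory.
Import numFieldNormedType.Exports.

Local Open Scope classical_set_scope.
Local Open Scope ring_scope.

(* A type with a topology and a group law; their compatibility is part of
   [is_lie_group]. *)
#[short(type="pretopGroupType")]
HB.structure Definition PreTopologicalGroup := {G of Topological G & Group G}.

Section Smooth.
Context {R : realType}.

(* C^k on an open set D.  All model spaces used below are finite-dimensional,
   so [x |-> 'd f x] is C^k iff [x |-> 'd f x v] is C^k for every v. *)
Fixpoint Ck_on {V W : normedModType R} (k : nat) (D : set V) (f : V -> W)
  : Prop :=
  match k with
  | 0%N => forall x, D x -> {for x, continuous f}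
  | k'.+1 => (forall x, D x -> differentiable f x) /\
             (forall v : V, Ck_on k' D (fun x => 'd f x v))
  end.

Definition smooth_on {V W : normedModType R} (D : set V) (f : V -> W) : Prop :=
  forall k, Ck_on k D f.

(* A local chart of M modelled on V.  Both maps are total, but only the values
   of [chart_map] on [dom] and of [param] on [chart_map @` dom] are meaningful. *)
Record chart (V M : Type) := Chart {
  dom : set M;
  chart_map : M -> V;
  param : V -> M }.

Definition is_chart {V : normedModType R} {M : topologicalType}
    (c : chart V M) : Prop :=
  [/\ open (dom c), open (chart_map c @` dom c),
      forall p, dom c p -> param c (chart_map c p) = p,
      forall p, dom c p -> {for p, continuous (chart_map c)} &
      forall z, (chart_map c @` dom c) z -> {for z, continuous (param c)}].

Definition is_smooth_atlas {V : normedModType R} {M : topologicalType}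
    (A : set (chart V M)) : Prop :=
  [/\ forall c, A c -> is_chart c,
      forall p, exists2 c, A c & dom c p &
      forall c c', A c -> A c' ->
        smooth_on (chart_map c @` (dom c `&` dom c')) (chart_map c' \o param c)].

Definition id_chart (V : Type) : chart V V := Chart setT id id.

Definition prod_chart {V W M N : Type} (c : chart V M) (c' : chart W N)
  : chart (V * W) (M * N) :=
  Chart (dom c `*` dom c')
        (fun p => (chart_map c p.1, chart_map c' p.2))
        (fun z => (param c z.1, param c' z.2)).

Definition prod_atlas {V W M N : Type}
    (A : set (chart V M)) (B : set (chart W N))
  : set (chart (V * W) (M * N)) :=
  [set c | exists a b, [/\ A a, B b & c = prod_chart a b]].

Definition smooth_map {V W : normedModType R} {M N : topologicalType}
    (A : set (chart V M)) (B : set (chart W N)) (f : M -> N) : Prop :=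
  continuous f /\
  forall a b, A a -> B b ->
    smooth_on (chart_map a @` (dom a `&` f @^-1` dom b))
              (chart_map b \o f \o param a).

End Smooth.

Section LieGroup.
Context {R : realType} {n : nat} {G : pretopGroupType}.
Variable A : set (chart 'rV[R]_n G).

Definition is_lie_group : Prop :=
  [/\ hausdorff_space G, second_countable (T := G), is_smooth_atlas A,
      smooth_map (prod_atlas A A) A (fun p : G * G => (p.1 * p.2)%g) &
      smooth_map A A (fun g : G => (g^-1)%g)].

(* The Lie algebra T_1 G is identified with R^n by the differential at 1 of a
   chart [c] around 1.  The exponential map is characterized as the map such
   that t |-> exp(t xi) is the one-parameter subgroup with velocity xi at 0. *)
Definition is_exponential (c : chart 'rV[R]_n G) (ex : 'rV[R]_n -> G) : Prop :=
  forall xi : 'rV[R]_n,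
  [/\ smooth_map [set id_chart R] A (fun t : R => ex (t *: xi)),
      forall s t : R, ex ((s + t) *: xi) = (ex (s *: xi) * ex (t *: xi))%g &
      is_derive (0 : R) 1 (fun t : R => chart_map c (ex (t *: xi))) xi].

Definition is_smooth_action {d : nat} (act : G -> 'rV[R]_d -> 'rV[R]_d)
  : Prop :=
  [/\ forall r, act 1%g r = r,
      forall g h r, act (g * h)%g r = act g (act h r) &
      smooth_map (prod_atlas A [set id_chart 'rV[R]_d]) [set id_chart 'rV[R]_d]
        (fun p : G * 'rV[R]_d => act p.1 p.2)].

End LieGroup.

Definition is_proper_action {R : realType} {G : pretopGroupType} {d : nat}
    (act : G -> 'rV[R]_d -> 'rV[R]_d) : Prop :=
  forall K : set ('rV[R]_d * 'rV[R]_d), compact K ->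
    compact ((fun p : G * 'rV[R]_d => (act p.1 p.2, p.2)) @^-1` K).

(* A configuration x = (r_1, ..., r_N) is an N x d matrix with rows r_i. *)
Section NBody.
Context {R : realType} {N d : nat}.
Variable m : 'I_N -> R.
Local Notation conf := 'M[R]_(N, d).

Definition dotE (r s : 'rV[R]_d) : R := \sum_(k < d) r 0 k * s 0 k.
(* The norm [`|r|] provided by the library on matrices is the sup norm. *)
Definition normE (r : 'rV[R]_d) : R := Num.sqrt (dotE r r).

Definition mass_dot (x y : conf) : R :=
  \sum_(i < N) m i * dotE (row i x) (row i y).
Definition mass_norm (x : conf) : R := Num.sqrt (mass_dot x x).

Definition potential (x : conf) : \bar R :=
  (\sum_(i < N) \sum_(j < N | (i < j)%N)
     if row i x == row j x then +oo
     else (m i * m j / normE (row i x - row j x))%:E)%E.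

Definition lagrangian (x v : conf) : \bar R :=
  ((2^-1 * mass_norm v ^+ 2)%:E + potential x)%E.

Definition abs_continuous (a b : R) (gamma : R -> conf) : Prop :=
  forall eps : R, 0 < eps -> exists2 delta : R, 0 < delta &
  forall (k : nat) (s t : 'I_k -> R),
    (forall i, [/\ a <= s i, s i <= t i & t i <= b]) ->
    trivIset setT (fun i => [set` `]s i, t i[]) ->
    \sum_(i < k) (t i - s i) < delta ->
    \sum_(i < k) `|gamma (t i) - gamma (s i)| < eps.

(* derive1 gamma exists almost everywhere on [a, b] for absolutely continuous
   gamma; it has the default value 0 elsewhere. *)
Definition action (a b : R) (gamma : R -> conf) : \bar R :=
  (\int[lebesgue_measure]_(t in `[a, b]) lagrangian (gamma t) (derive1 gamma t))%E.

Definition mane_potential (x y : conf) : \bar R :=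
  ereal_inf [set z | exists (a b : R) (gamma : R -> conf),
    [/\ a < b, abs_continuous a b gamma, gamma a = x, gamma b = y &
        z = action a b gamma]].

Definition dominated (u : conf -> R) : Prop :=
  forall x y, ((u y - u x)%:E <= mane_potential x y)%E.

(* A curve [0, +oo) -> E^N is represented by any extension R -> E^N; values at
   negative times play no role. *)
Definition calibrates (u : conf -> R) (gamma : R -> conf) : Prop :=
  (forall T : R, 0 < T -> abs_continuous 0 T gamma) /\
  (forall t : R, 0 < t -> (u (gamma 0) - u (gamma t))%:E = action 0 t gamma).

Definition weak_KAM (u : conf -> R) : Prop :=
  dominated u /\
  forall x, exists2 gamma : R -> conf, gamma 0 = x & calibrates u gamma.

End NBody.

Section Symmetry.
Context {R : realType} {n N d : nat} {G : pretopGroupType}.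
Variables (m : 'I_N -> R) (act : G -> 'rV[R]_d -> 'rV[R]_d).
Local Notation conf := 'M[R]_(N, d).

Definition diag_act (g : G) (x : conf) : conf :=
  \matrix_(i < N) act g (row i x).

Definition lagrangian_invariant : Prop :=
  forall (g : G) (x v : conf),
    lagrangian m (diag_act g x) ('d (diag_act g) x v) = lagrangian m x v.

Definition lift_isometric : Prop :=
  forall (g : G) (x v w : conf),
    mass_dot m ('d (diag_act g) x v) ('d (diag_act g) x w) = mass_dot m v w.

Definition generator (ex : 'rV[R]_n -> G) (xi : 'rV[R]_n) (x : conf) : conf :=
  derive1 (fun t : R => diag_act (ex (t *: xi)) x) 0.

(* ['Hom('rV[R]_n, R^o)] is the dual of the Lie algebra R^n. *)
Definition is_momentum_map (ex : 'rV[R]_n -> G)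
    (mu : conf -> conf -> 'Hom('rV[R]_n, R^o)) : Prop :=
  forall (x v : conf) (xi : 'rV[R]_n),
    mu x v xi = mass_dot m v (generator ex xi x).

Definition invariant_fun (u : conf -> R) : Prop :=
  forall (g : G) (x : conf), u (diag_act g x) = u x.

End Symmetry.

(* Main.v *)
Require Import Defs.
From HB Require Import structures.
From mathcomp Require Import all_boot all_order all_algebra.
From mathcomp Require Import all_classical all_reals all_analysis.
From mathcomp Require Import measurable_realfun ring lra.
Import Order.TTheory GRing.Theory Num.Theory.
Import numFieldNormedType.Exports.
Local Open Scope classical_set_scope.
Local Open Scope ring_scope.
Set Implicit Arguments.
Unset Strict Implicit.
Unset Printing Implicit Defensive.

(** Both implications come from one family of competitors. Let gamma calibrate
    u, let T > 0, and run gamma backwards on [0, T] while letting a symmetry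
    act: beta t = S_g S_(exp (t xi)) gamma (T - t). Since L is invariant, the
    Lagrangian along beta is L (gamma, gamma' - X_xi gamma) at time T - t, and
    since u is dominated, the action of beta bounds an increment of u. The
    isometry condition is used to see that beta is absolutely continuous.
    Expanding the square, with e xi for xi and with the calibration of gamma
    on [0, T], gives [first_variation]:
      u (S_g S_(exp (T e xi)) gamma 0) - u (S_g gamma T)
        <= u (gamma 0) - u (gamma T)
           - e * int_0^T gamma' . X_xi gamma + e^2 / 2 * int_0^T |X_xi gamma|^2.

    If u is invariant, the increments of u cancel and the inequality for all
    real e forces int_0^T gamma' . X_xi gamma = 0 for every T
    ([mean_momentum_zero]). To get the momentum at a given time t0, and not
    only at almost every time, where gamma is differentiable, the increment
    (gamma t - gamma t0) . X_xi (gamma t0) is compared with the vanishing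
    integral of gamma' . X_xi gamma on [t0, t]; as X_xi gamma moves by
    O (t - t0) and gamma' has finite energy, the increment is o (t - t0)
    ([increment_bound], [calibrated_momentum_zero]). Where gamma is not
    differentiable the velocity is zero by convention.

    If the momentum vanishes along calibrating curves, the first variation has
    no linear term, so u (S_(exp (e xi)) x) - u x <= C e^2
    ([orbit_quadratic]). At configurations without collision u is locally
    Lipschitz ([dominated_lipschitz]), because the potential is locally
    bounded there. Hence along a segment drawn in a chart of G, whose velocity
    at each time is that of a one-parameter subgroup, s |-> u (S_(g s) x) is
    continuous with nonpositive upper Dini derivatives on both sides, so it is
    constant ([path_constant]). Connectedness of G gives the invariance at
    collision-free x ([collision_free_invariant]). A calibrating curve from an
    arbitrary x has finite action, so it is collision-free at some t > 0; the
    first variation on [0, t] with e = 0 then reads u (S_g x) <= u x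
    ([invariant_le]), and g^-1 gives equality.

    The analysis rests on the fundamental theorem of calculus for absolutely
    continuous functions ([abs_cont_on_density]): the total variation of an
    absolutely continuous function is absolutely continuous, so f is a
    difference of nondecreasing absolutely continuous functions; their
    Stieltjes measures are dominated by the Lebesgue measure, and the
    Radon-Nikodym density is the derivative almost everywhere. *)

(** * Absolutely continuous functions of a real variable *)

(** Absolute continuity on the whole line: composing with a projection onto
    [a, b] reduces the case of a segment to this one, free of endpoint
    conditions. *)
Definition abs_cont {R : realType} (f : R -> R) : Prop :=
  forall eps : R, 0 < eps -> exists2 delta : R, 0 < delta &
  forall (k : nat) (s t : 'I_k -> R),
    (forall i, s i <= t i) ->
    trivIset setT (fun i => [set` `]s i, t i[]) ->
    \sum_(i < k) (t i - s i) < delta ->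
    \sum_(i < k) `|f (t i) - f (s i)| < eps.

Section Variation.
Context {R : realType}.
Implicit Types (f : R -> R) (a b : R).

(** With an arbitrary finite index type the subintervals of several partitions
    can be taken together, indexed by a sigma type. *)
Lemma abs_cont_finType f (eps : R) : abs_cont f -> 0 < eps ->
  exists2 delta : R, 0 < delta &
  forall (I : finType) (s t : I -> R), (forall i, s i <= t i) ->
    trivIset setT (fun i => [set` `]s i, t i[]) ->
    \sum_i (t i - s i) < delta -> \sum_i `|f (t i) - f (s i)| < eps.
Proof.
move=> fAC /fAC[delta delta0 fdelta]; exists delta => // I s t st tI sumst.
rewrite (reindex _ (onW_bij _ (enum_val_bij I))) /=; apply: fdelta => //.
- move=> i j _ _ ij; apply: enum_val_inj; exact: tI.
- by move: sumst; rewrite (reindex _ (onW_bij _ (enum_val_bij I))).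
Qed.

Lemma itv_partition_nth_mono a b (l : seq R) : itv_partition a b l ->
  forall i j, (i <= j)%N -> (j <= size l)%N ->
  nth b (a :: l) i <= nth b (a :: l) j.
Proof.
case=> al _ i j ij jl.
have srt : sorted <=%O (a :: l).
  by apply: (@sub_sorted _ <%O) => //= x y; exact: ltW.
by apply: (le_sorted_leq_nth b srt) => //; rewrite inE/= ltnS // (leq_trans ij).
Qed.

Lemma itv_partition_last a b (l : seq R) : itv_partition a b l ->
  nth b (a :: l) (size l) = b.
Proof. by case=> _ /eqP lb; rewrite (_ : size l = (size (a :: l)).-1) // nth_last. Qed.

(** All the subintervals of the partitions l i form a single family of disjoint
    intervals, of the same total length as the family s i, t i. *)
Lemma abs_cont_variation f (eps : R) : abs_cont f -> 0 < eps ->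
  exists2 delta : R, 0 < delta &
  forall (k : nat) (s t : 'I_k -> R) (l : 'I_k -> seq R),
    (forall i, itv_partition (s i) (t i) (l i)) ->
    trivIset setT (fun i => [set` `]s i, t i[]) ->
    \sum_(i < k) (t i - s i) < delta ->
    \sum_(i < k) variation (s i) (t i) f (l i) < eps.
Proof.
move=> fAC eps0; have [delta delta0 fdelta] := abs_cont_finType fAC eps0.
exists delta => // k s t l stl tI sumst.
pose pt i := nth (t i) (s i :: l i).
have mono i p q : (p <= q)%N -> (q <= size (l i))%N -> pt i p <= pt i q.
  exact: (itv_partition_nth_mono (stl i)).
have ptt i : pt i (size (l i)) = t i by exact: itv_partition_last.
under eq_bigr => i _ do rewrite /variation big_mkord.
rewrite (@sig_big_dep _ _ _ _ _ predT (fun i => predT)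
  (fun i (j : 'I_(size (l i))) => `|f (pt i j.+1) - f (pt i j)|)) /=.
apply: (fdelta _ (fun p : {i : 'I_k & 'I_(size (l i))} => pt (tag p) (tagged p))
                 (fun p => pt (tag p) (tagged p).+1)).
- by move=> [i j] /=; apply: mono => //.
- move=> [i p] [j q] _ _ [x [/=]]; rewrite !in_itv/= => /andP[ip1 ip2] /andP[jq1 jq2].
  have in_st (i' : 'I_k) (p' : 'I_(size (l i'))) :
      pt i' p' < x -> x < pt i' p'.+1 -> s i' < x < t i'.
    move=> h1 h2; rewrite (le_lt_trans _ h1)/=; last by apply: (mono i' 0%N) => //; exact: ltnW.
    by rewrite (lt_le_trans h2)// -ptt mono.
  have ij : i = j.
    apply: tI => //; exists x; split; rewrite /= in_itv/=;
      [exact: (in_st _ _ ip1 ip2)|exact: (in_st _ _ jq1 jq2)].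
  case: _ / ij q jq1 jq2 => q jq1 jq2; congr existT; apply/val_inj/eqP => /=.
  rewrite eqn_leq; apply/andP; split; rewrite leqNgt; apply/negP => pq.
    by have := lt_le_trans jq2 (mono i _ _ pq (ltnW (ltn_ord p))); rewrite ltNge ltW.
  by have := lt_le_trans ip2 (mono i _ _ pq (ltnW (ltn_ord q))); rewrite ltNge ltW.
- rewrite -(@sig_big_dep _ _ _ _ _ predT (fun i => predT)
    (fun i (j : 'I_(size (l i))) => pt i j.+1 - pt i j)) /=.
  under eq_bigr => i _.
    rewrite -(big_mkord xpredT (fun j => pt i j.+1 - pt i j)) telescope_sumr// ptt.
    over.
  by [].
Qed.

Lemma abs_cont_total_variation f (eps : R) : abs_cont f -> 0 < eps ->
  exists2 delta : R, 0 < delta &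
  forall s t : R, s <= t -> t - s < delta -> (total_variation s t f <= eps%:E)%E.
Proof.
move=> fAC eps0; have [delta delta0 fdelta] := abs_cont_variation fAC eps0.
exists delta => // s t st std; apply: ge_ereal_sup => _ [_ [l stl <-] <-].
rewrite lee_fin.
have := fdelta 1%N (fun=> s) (fun=> t) (fun=> l) (fun=> stl).
rewrite !big_ord1 => h; apply/ltW/h => // i j _ _ _.
by rewrite [i]ord1 [j]ord1.
Qed.

(** On an interval shorter than the delta that goes with eps = 1 the variation is
    at most 1, and finitely many of these cover [a, b]. *)
Lemma abs_cont_total_variation_fin f a b : abs_cont f -> a <= b ->
  total_variation a b f \is a fin_num.
Proof.
move=> fAC ab; have [delta delta0 fdelta] := abs_cont_total_variation fAC ltr01.
(* induction on the number n of steps of length e needed to reach c *)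
pose e := delta / 2; have e0 : 0 < e by rewrite divr_gt0.
have ed : e < delta by rewrite ltr_pdivrMr// ltr_pMr// ltr1n.
suff H (n : nat) (c : R) : a <= c -> c - a <= e *+ n ->
    (total_variation a c f < +oo)%E.
  rewrite ge0_fin_numE ?total_variation_ge0//.
  apply: (H (Num.bound ((b - a) / e))) => //.
  rewrite -mulr_natr -ler_pdivrMl// mulrC; apply: ltW.
  by apply: archi_boundP; rewrite divr_ge0 ?subr_ge0// ltW.
elim: n c => [|n IH] c ac.
  rewrite mulr0n subr_le0 => ca.
  by rewrite (@le_anti _ _ c a) ?ac ?ca// total_variationxx.
rewrite mulrS => can.
have [h|h] := leP c (a + e).
  apply: le_lt_trans (ltry 1); apply: fdelta => //.
  by rewrite (le_lt_trans _ ed)// lerBlDl.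
have ace : a <= c - e by rewrite lerBrDr ltW.
rewrite (@total_variationD _ _ _ (c - e))//; last by rewrite gerBl ltW.
apply: lte_add_pinfty.
  by apply: IH => //; rewrite addrAC lerBlDl.
apply: le_lt_trans (ltry 1); apply: fdelta => //; first by rewrite gerBl ltW.
by rewrite opprB addrC subrK.
Qed.

(** The maximum makes this function constant on the left of a, hence
    nondecreasing on the whole line. *)
Definition variation_from a f x := fine (total_variation a (Num.max a x) f).

Lemma variation_fromB a f x y : abs_cont f -> x <= y ->
  variation_from a f y - variation_from a f x =
  fine (total_variation (Num.max a x) (Num.max a y) f).
Proof.
move=> fAC xy; have axy : Num.max a x <= Num.max a y by rewrite ge_max !le_max lexx xy orbT.
rewrite /variation_from (total_variationD f _ axy) ?le_max ?lexx//.
rewrite fineD; first by rewrite addrAC subrr add0r.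
  by apply: abs_cont_total_variation_fin => //; rewrite le_max lexx.
exact: abs_cont_total_variation_fin.
Qed.

Lemma variation_from_mono a f : abs_cont f ->
  {homo variation_from a f : x y / x <= y}.
Proof.
move=> fAC x y xy; rewrite -subr_ge0 variation_fromB// fine_ge0//.
by rewrite total_variation_ge0// ge_max !le_max lexx xy orbT.
Qed.

Lemma variation_from_increment a f x y : abs_cont f -> a <= x -> x <= y ->
  f y - f x <= variation_from a f y - variation_from a f x.
Proof.
move=> fAC ax xy; rewrite variation_fromB// !max_r//; last exact: le_trans xy.
rewrite (le_trans (ler_norm _))// -lee_fin fineK ?abs_cont_total_variation_fin//.
exact: total_variation_ge.
Qed.

(** The variation over each of the given intervals is approached by a partition
    with an error eta, and these errors add up to at most eps / 2. *)
Lemma variation_from_abs_cont a f : abs_cont f -> abs_cont (variation_from a f).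
Proof.
move=> fAC eps eps0; have eps2 : 0 < eps / 2 by rewrite divr_gt0.
have [delta delta0 fdelta] := abs_cont_variation fAC eps2.
exists delta => // k s t st tI sumst.
pose s' i := Num.max a (s i); pose t' i := Num.max a (t i).
have st' i : s' i <= t' i by rewrite /s' /t' ge_max !le_max lexx st orbT.
pose eta := eps / 2 / k.+1%:R; have eta0 : 0 < eta by rewrite divr_gt0.
have ex i : exists l, itv_partition (s' i) (t' i) l /\
    fine (total_variation (s' i) (t' i) f) - eta <= variation (s' i) (t' i) f l.
  have fin := abs_cont_total_variation_fin fAC (st' i).
  have [_ [_ [l lP <-] <-]] := ub_ereal_sup_adherent eta0 fin.
  rewrite -/(total_variation _ _ _) -(fineK fin) -EFinB lte_fin => /ltW h.
  by exists l.
have [l lP] := choice ex.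
have lst i : itv_partition (s' i) (t' i) (l i) by have [] := lP i.
apply: (@le_lt_trans _ _ (\sum_(i < k) (variation (s' i) (t' i) f (l i) + eta))).
  apply: ler_sum => i _; rewrite ger0_norm; last first.
    by rewrite subr_ge0 variation_from_mono.
  by rewrite variation_fromB// -lerBlDr; have [] := lP i.
have sub i : [set` `]s' i, t' i[] `<=` [set` `]s i, t i[].
  move=> x /=; rewrite !in_itv/= /s' /t' gt_max lt_max => /andP[/andP[ax ->]].
  by rewrite [x < a]ltNge (ltW ax).
rewrite big_split/= sumr_const card_ord [ltRHS](splitr eps).
apply: ltr_leD; last first.
  rewrite -[leLHS]mulr_natr /eta -[leLHS]mulrA ler_piMr ?(ltW eps2)//.
  by rewrite mulrC ler_pdivrMr// mul1r ler_nat.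
apply: fdelta => //.
  move=> i j _ _ [x [/sub xi /sub xj]]; by apply: tI => //; exists x.
apply: le_lt_trans sumst; apply: ler_sum => i _; rewrite /s' /t'.
rewrite lerBlDr; have := st i.
by case: (leP a (s i)); case: (leP a (t i)) => //; lra.
Qed.

End Variation.

(** The codomain of the ascription selects the Borel sigma-algebra of R. *)
Definition stieltjes {R : realType} (g : cumulative R R) :
  set (measurableTypeR R) -> \bar R := lebesgue_stieltjes_measure g.
HB.instance Definition _ (R : realType) (g : cumulative R R) :=
  Measure.on (stieltjes g).

Section Density.
Context {R : realType}.
Notation mu := (@lebesgue_measure R).

Lemma abs_cont_continuous (f : R -> R) : abs_cont f -> continuous f.
Proof.
move=> fAC x; apply/(@cvgrPdist_lt _ R^o) => eps eps0.
have [delta delta0 fdelta] := abs_cont_finType fAC eps0.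
near=> y.
have : `|x - y| < delta by near: y; apply: cvgr_dist_lt.
have fam (s t : R) : s <= t -> t - s < delta -> `|f t - f s| < eps.
  move=> st std; have := fdelta unit (fun=> s) (fun=> t) (fun=> st).
  rewrite !big_const/= card_unit/= !addr0; apply => //.
  by move=> [] [].
have [xy|yx] := leP x y.
  by rewrite distrC ger0_norm ?subr_ge0// => /(fam _ _ xy); rewrite distrC.
by rewrite ger0_norm ?subr_ge0 ?(ltW yx)//; apply: fam; exact: ltW.
Unshelve. all: by end_near. Qed.

Lemma open_interval_oo (I : set R) : open I -> is_interval I ->
  (mu I < +oo)%E -> exists s t : R, s <= t /\ I = [set` `]s, t[].
Proof.
move=> oI iI.
have [->|/set0P[x Ix]] := eqVneq I set0.
  by exists 0, 0; split => //; rewrite set_itv_ge// bnd_simp ltxx.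
have := RhullK (mem_set iI); case: (Rhull I) => i j IE.
move: Ix oI; rewrite -{}IE {I iI} => xij oij.
have noleft s j' : [set` Interval (BLeft s) j'] = [set` Interval i j] ->
    s \in Interval (BLeft s) j' -> False.
  move=> E sI; have : [set` Interval i j] s by rewrite -E.
  move=> /(conj oij)/open_nbhs_nbhs/nbhs_ballP[e /= e0 /(_ (s - e / 2))].
  rewrite -E /= /ball/= opprB addrCA subrr addr0 ger0_norm ?divr_ge0 ?ltW//.
  rewrite ltr_pdivrMr// ltr_pMr// ltr1n => /(_ isT).
  by rewrite in_itv/= lerBrDr gerDl => /andP[]; rewrite leNgt divr_gt0.
have noright t i' : [set` Interval i' (BRight t)] = [set` Interval i j] ->
    t \in Interval i' (BRight t) -> False.
  move=> E sI; have : [set` Interval i j] t by rewrite -E.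
  move=> /(conj oij)/open_nbhs_nbhs/nbhs_ballP[e /= e0 /(_ (t + e / 2))].
  rewrite -E /= /ball/= opprD addrA subrr add0r normrN ger0_norm ?divr_ge0 ?ltW//.
  rewrite ltr_pdivrMr// ltr_pMr// ltr1n => /(_ isT).
  by rewrite in_itv/= gerDl => /andP[_]; rewrite leNgt divr_gt0.
move: i j xij noleft noright {oij} => [[] s|[]] [[] t|[]]//= xij noleft noright;
  rewrite ?lebesgue_measure_itv/= ?ltNyr ?ltry//=.
all: move: xij; rewrite /= ?in_itv/= ?andbF// => /andP[sx xt] _.
- by have [] := noleft s _ erefl; rewrite in_itv/= lexx (le_lt_trans sx).
- by have [] := noleft s _ erefl; rewrite in_itv/= lexx (le_trans sx).
- by exists s, t; split => //; rewrite ltW// (lt_trans sx).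
- by have [] := noright t _ erefl; rewrite in_itv/= lexx (lt_le_trans sx).
Qed.

Lemma stieltjes_oc (g : cumulative R R) (a b : R) : a <= b ->
  stieltjes g [set` `]a, b]] = (g b - g a)%:E.
Proof.
move=> ab; rewrite /stieltjes /lebesgue_stieltjes_measure /measure_extension.
rewrite measurable_mu_extE/=; last exact: is_ocitv.
by rewrite wlength_itv_bnd.
Qed.

(** A null set lies in an open set U with Lebesgue measure less than delta. The
    components of U are disjoint open intervals, so the increments of g on any
    finite number of them add up to less than eps, and so does the Stieltjes
    measure of U. *)
Lemma stieltjes_dominated (g : cumulative R R) : abs_cont g ->
  stieltjes g `<< mu.
Proof.
move=> gAC; apply/null_content_dominatesP => N mN N0.
apply/eqP; rewrite -measure_le0; apply/lee_addgt0Pr => eps eps0; rewrite add0e.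
have [delta delta0 gdelta] := gAC _ eps0.
have N_fin : (mu N < +oo)%E by rewrite [X in (X < _)%E]N0 ltry.
have [U [oU NU UN]] := lebesgue_regularity_outer mN N_fin delta0.
have {UN N_fin}Ud : (mu U < delta%:E)%E.
  rewrite (_ : U = (U `\` N) `|` N); last by rewrite setUC setDUK.
  apply: le_lt_trans (measureU2 _ _ _) _ => //=.
    by apply: measurableD => //; exact: open_measurable.
  by rewrite [X in (_ + X)%E]N0 adde0.
apply: (@le_trans _ _ (stieltjes g U)).
  by apply: le_measure; rewrite ?inE//; exact: open_measurable.
pose I := open_disjoint_itv oU.
have mU : measurable U by exact: open_measurable.
have mI q : measurable (I q) by apply: open_measurable; exact: open_disjoint_itv_open.
have UI : U = \bigcup_q I q by exact: open_disjoint_itv_bigcup.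
have tI : trivIset setT I by exact: open_disjoint_itv_trivIset.
have I_fin q : (mu (I q) < +oo)%E.
  apply: le_lt_trans (lt_trans Ud (ltry _)); apply: le_measure; rewrite ?inE; [exact: mI|exact: mU|].
  by rewrite UI; exact: bigcup_sup.
have /choice[s /choice[t st]] : forall q, exists s t : R, s <= t /\ I q = [set` `]s, t[].
  move=> q; apply: open_interval_oo => //; first exact: open_disjoint_itv_open.
  exact: open_disjoint_itv_is_interval.
rewrite UI measure_bigcup//=; last by move=> q _; exact: mI.
apply: lime_le; first by apply: is_cvg_nneseries => n _ _; exact: measure_ge0.
apply: nearW => n.
have muI q : mu (I q) = (t q - s q)%:E.
  have [sq ->] := st q; rewrite lebesgue_measure_itv/= lte_fin.
  by case: ltP => // ts; rewrite (@le_anti _ _ (s q) (t q)) ?sq// subrr.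
have nuI q : (stieltjes g (I q) <= `|g (t q) - g (s q)|%:E)%E.
  have [sq ->] := st q.
  rewrite ger0_norm ?subr_ge0 ?cumulative_is_nondecreasing//.
  rewrite -stieltjes_oc//; apply: le_measure; rewrite ?inE//=.
  exact: subset_itv_oo_oc.
rewrite (eq_bigl xpredT) => [|q]; last by rewrite in_setT.
rewrite big_mkord.
apply: (@le_trans _ _ (\sum_(i < n) `|g (t i) - g (s i)|%:E)%E).
  by apply: lee_sum => i _; exact: nuI.
rewrite sumEFin lee_fin ltW// (gdelta n (fun i => s i) (fun i => t i))//.
- by move=> i; have [] := st i.
- move=> i j _ _ [x []]; have [_ <-] := st i; have [_ <-] := st j => xi xj.
  by apply: val_inj; apply: tI => //; exists x.
- rewrite -lte_fin -sumEFin (eq_bigr (fun i : 'I_n => mu (I i))); last first.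
    by move=> i _; rewrite muI.
  rewrite -measure_bigsetU//.
  apply: le_lt_trans Ud; apply: le_measure; rewrite ?inE.
  + by apply: bigsetU_measurable => i _; exact: mI.
  + exact: mU.
  + by rewrite UI; exact: bigsetU_bigcup.
Qed.

Lemma stieltjes_finite (g : cumulative R R) (M : R) : (forall x, `|g x| <= M) ->
  (stieltjes g setT < +oo)%E.
Proof.
move=> gM; rewrite -(bigcup_itvT false false).
pose I n : set R := `]- (n%:R), n%:R]%classic.
have : (stieltjes g \o I) n @[n --> \oo] -->
    stieltjes g (\bigcup_n I n).
  apply: nondecreasing_cvg_mu; rewrite /I//; first exact: bigcup_measurable.
  by move=> *; apply/subsetPset/subset_itv; rewrite leBSide/= ?lerN2 ler_nat.
move=> h; rewrite -(cvg_lim _ h)//; apply: (@le_lt_trans _ _ (M + M)%:E).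
  2: exact: ltry.
apply: lime_le; first by apply/cvg_ex; eexists; exact: h.
apply: nearW => n /=; rewrite /I stieltjes_oc ?ge0_cp// lee_fin.
apply: lerD; first exact: le_trans (ler_norm _) _.
by rewrite (le_trans (ler_norm _))// normrN.
Qed.

Lemma monotone_abs_cont_density (g : R -> R) (M : R) : {homo g : x y / x <= y} ->
  (forall x, `|g x| <= M) -> abs_cont g ->
  exists h : R -> R, mu.-integrable setT (EFin \o h) /\
    forall x y, x <= y ->
      (\int[mu]_(t in `]x, y]) (h t)%:E)%E = (g y - g x)%:E.
Proof.
move=> gnd gM gAC.
have gc : right_continuous g by apply: right_continuousW; exact: abs_cont_continuous.
pose G : cumulative R R := HB.pack g (isCumulative.Build R _ R g gnd gc).
have finG : fin_num_fun (stieltjes G).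
  move=> U mU; rewrite ge0_fin_numE//; apply: le_lt_trans (@stieltjes_finite G M gM).
  by apply: le_measure; rewrite ?inE.
pose nu : {finite_measure set (measurableTypeR R) -> \bar R} :=
  HB.pack (stieltjes G : set (measurableTypeR R) -> \bar R) (Measure.on (stieltjes G))
    (Measure_isFinite.Build _ _ _ (stieltjes G) finG).
have := @radon_nikodym_sigma_finite _ _ R mu nu (@stieltjes_dominated G gAC).
move=> [f [f0 ffin fint nuf]].
have fE : f = EFin \o (fine \o f) by apply/funext => x /=; rewrite fineK.
exists (fine \o f); split; first by rewrite -fE.
move=> x y xy; rewrite -(@stieltjes_oc G)//.
rewrite -[LHS]/(\int[mu]_(t in `]x, y]) (EFin \o (fine \o f)) t)%E -fE.
by rewrite -nuf.
Qed.

Definition clamp (a b x : R) : R := Num.max a (Num.min b x).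

Lemma clamp_ge a b x : a <= clamp a b x.
Proof. by rewrite /clamp le_max lexx. Qed.

Lemma clamp_le a b x : a <= b -> clamp a b x <= b.
Proof. by move=> ab; rewrite /clamp ge_max ab ge_min lexx. Qed.

Lemma clamp_id a b x : a <= x <= b -> clamp a b x = x.
Proof. by move=> /andP[ax xb]; rewrite /clamp min_r// max_r. Qed.

Lemma le_clamp a b x y : x <= y -> clamp a b x <= clamp a b y.
Proof.
by move=> xy; rewrite /clamp ge_max le_max lexx /= le_max le_min !ge_min lexx xy !orbT.
Qed.

Lemma clampB a b x y : x <= y -> clamp a b y - clamp a b x <= y - x.
Proof.
move=> xy; rewrite /clamp.
by case: (leP b x); case: (leP b y) => ?; case: (leP a b); case: (leP a x); case: (leP a y); lra.
Qed.

Lemma clamp_lt_itv a b s t x : clamp a b s < x -> x < clamp a b t -> s < x < t.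
Proof.
rewrite /clamp gt_max gt_min lt_max lt_min => /andP[ax /orP[bx|->]].
  by rewrite ltNge (ltW ax) /= => /andP[]; rewrite ltNge ltW.
by rewrite [x < a]ltNge (ltW ax) /= => /andP[].
Qed.

Lemma clamp_clamp a b x : a <= b -> clamp a b (clamp a b x) = clamp a b x.
Proof. by move=> ab; rewrite clamp_id// clamp_ge clamp_le. Qed.

Definition abs_cont_on (a b : R) (f : R -> R) : Prop :=
  forall eps : R, 0 < eps -> exists2 delta : R, 0 < delta &
  forall (k : nat) (s t : 'I_k -> R),
    (forall i, [/\ a <= s i, s i <= t i & t i <= b]) ->
    trivIset setT (fun i => [set` `]s i, t i[]) ->
    \sum_(i < k) (t i - s i) < delta ->
    \sum_(i < k) `|f (t i) - f (s i)| < eps.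

Lemma abs_cont_clamp a b (f : R -> R) : a <= b -> abs_cont_on a b f ->
  abs_cont (f \o clamp a b : R -> R).
Proof.
move=> ab fAC eps /fAC[delta delta0 fdelta]; exists delta => // k s t st tI sumst.
apply: (fdelta k (clamp a b \o s) (clamp a b \o t)) => /=.
- by move=> i; rewrite clamp_ge clamp_le// le_clamp.
- move=> i j _ _ [x [/=]]; rewrite !in_itv/= => /andP[xi1 xi2] /andP[xj1 xj2].
  apply: tI => //; exists x; split => /=; rewrite in_itv/=.
    exact: (clamp_lt_itv xi1).
  exact: (clamp_lt_itv xj1).
- by apply: le_lt_trans sumst; apply: ler_sum => i _; exact: clampB.
Qed.

Lemma abs_cont_restrict a b (f : R -> R) : abs_cont f -> abs_cont_on a b f.
Proof.
move=> fAC eps /fAC[delta delta0 fdelta]; exists delta => // k s t st tI.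
by apply: fdelta => // i; have [] := st i.
Qed.

Lemma abs_contB (f g : R -> R) : abs_cont f -> abs_cont g -> abs_cont (f \- g).
Proof.
move=> fAC gAC eps eps0; have eps2 : 0 < eps / 2 by rewrite divr_gt0.
have [d1 d10 fd] := fAC _ eps2; have [d2 d20 gd] := gAC _ eps2.
exists (Num.min d1 d2); first by rewrite lt_min d10.
move=> k s t st tI; rewrite lt_min => /andP[h1 h2].
rewrite [ltRHS](splitr eps).
apply: le_lt_trans (ltrD (fd k s t st tI h1) (gd k s t st tI h2)).
rewrite -big_split/=; apply: ler_sum => i _.
rewrite /= [X in `|X|](_ : _ = (f (t i) - f (s i)) - (g (t i) - g (s i))).
  exact: ler_normB.
by lra.
Qed.

(** Jordan decomposition: V and V - f are nondecreasing. As f does not vary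
    outside [a, b], both are bounded and have finite Stieltjes measures. *)
Lemma clamp_density (f : R -> R) a b : a <= b -> abs_cont f ->
  (forall x, f (clamp a b x) = f x) ->
  exists h : R -> R, mu.-integrable setT (EFin \o h) /\
    forall x y, x <= y -> \int[mu]_(t in `]x, y]) h t = f y - f x.
Proof.
move=> ab fAC fclamp.
pose V := variation_from a f \o clamp a b.
have VAC : abs_cont V.
  by apply: abs_cont_clamp => //; apply/abs_cont_restrict/variation_from_abs_cont.
have Vnd : {homo V : x y / x <= y}.
  by move=> x y xy; apply: variation_from_mono => //; exact: le_clamp.
have WAC : abs_cont (V \- f) by exact: abs_contB.
have Wnd : {homo (V \- f) : x y / x <= y}.
  move=> x y xy /=; rewrite -(fclamp x) -(fclamp y).
  have := variation_from_increment fAC (clamp_ge a b x) (le_clamp a b xy).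
  by rewrite /V/=; lra.
have bnd (g : R -> R) : {homo g : x y / x <= y} -> (forall x, g (clamp a b x) = g x) ->
    forall x, `|g x| <= `|g a| + `|g b|.
  move=> gnd gc x; rewrite -gc.
  have := gnd _ _ (clamp_ge a b x); have := gnd _ _ (clamp_le x ab).
  have := normr_ge0 (g a); have := normr_ge0 (g b).
  by rewrite ler_norml; have := ler_norm (g b); have := ler_norm (- g a); rewrite normrN; lra.
have Vc x : V (clamp a b x) = V x by rewrite /V/= clamp_clamp.
have [p [pint pE]] := monotone_abs_cont_density Vnd (bnd _ Vnd Vc) VAC.
have Wc x : (V \- f) (clamp a b x) = (V \- f) x by rewrite /= Vc fclamp.
have [q [qint qE]] := monotone_abs_cont_density Wnd (bnd _ Wnd Wc) WAC.
exists (p \- q); split.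
  by rewrite (_ : _ \o _ = (EFin \o p) \- (EFin \o q))%E//; exact: integrableB.
move=> x y xy.
rewrite RintegralB//; first last.
- exact: integrableS qint.
- exact: integrableS pint.
by rewrite /Rintegral pE// qE//= ; lra.
Qed.

(** The density h of the extension of f by constants is integrable, so by
    Lebesgue's differentiation theorem its primitive has derivative h almost
    everywhere; this primitive is f up to a constant inside [a, b]. *)
Theorem abs_cont_on_density (f : R -> R) a b : a <= b -> abs_cont_on a b f ->
  exists h : R -> R, [/\ mu.-integrable setT (EFin \o h),
    forall x y, a <= x -> x <= y -> y <= b ->
      \int[mu]_(t in `]x, y]) h t = f y - f x &
    {ae mu, forall x, a < x -> x < b -> is_derive x 1 f (h x)}].
Proof.
move=> ab fAC.
have fc x : (f \o clamp a b) (clamp a b x) = (f \o clamp a b) x by rewrite /= clamp_clamp.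
have [h [hint hE]] := clamp_density ab (abs_cont_clamp ab fAC) fc.
exists h; split => //.
  by move=> x y ax xy yb; rewrite hE//= !clamp_id// ?ax ?(le_trans xy)// (le_trans ax).
have lh : locally_integrable [set: R] h by apply: open_integrable_locally => //; exact: openT.
have hy y : mu.-integrable [set` Interval (BRight a) (BRight y)] (EFin \o h).
  exact: integrableS hint.
have := FTC1 hy lh; apply: filterS.
  exact: (ae_filter_ringOfSetsType mu).
move=> x /= FTC ax xb; have [D1 D2] := FTC ax.
have near_f : \forall y \near x, \int[mu]_(t in `]a, y]) h t + f a = f y.
  near=> z; have az : a < z by near: z; exact: lt_nbhsr.
  have zb : z < b by near: z; exact: lt_nbhsl.
  have zE : clamp a b z = z by rewrite clamp_id// !ltW.
  have aE : clamp a b a = a by rewrite clamp_id// lexx.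
  by rewrite hE ?ltW//= zE aE subrK.
apply: near_eq_is_derive near_f _.
rewrite -[h x]addr0; apply: is_deriveD.
by apply: DeriveDef; [exact: D1|rewrite -derive1E; exact: D2].
Unshelve. all: by end_near. Qed.

End Density.

(** * Integrals of nonmeasurable integrands and time reversal *)

Section Integration.
Context {R : realType}.
Notation mu := (@lebesgue_measure R).
Local Open Scope ereal_scope.

Lemma measurable_reflection (T : R) : measurable_fun [set: R] (fun t : R => (T - t)%R).
Proof. exact: measurable_funB. Qed.

Lemma reflection_measure (T : R) (A : set R) : measurable A ->
  mu ((fun t => T - t)%R @^-1` A) = mu A.
Proof.
pose r : measurableTypeR R -> measurableTypeR R := (fun t => T - t)%R.
have mr : measurable_fun setT r by exact: measurable_reflection.
move=> mA; apply/esym.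
apply: (@lebesgue_measure_unique R (pushforward mu r)) mA.
move=> _ [[a b] _ <-] /=.
rewrite /pushforward /r.
rewrite [X in _ = mu X](_ : _ = [set` `[(T - b)%R, (T - a)%R[]); last first.
  by apply/seteqP; split => x /=; rewrite !in_itv/= => /andP[? ?]; apply/andP; split; lra.
rewrite !lebesgue_measure_itv/= !lte_fin ltrD2l ltrN2; case: ifPn => // _.
by rewrite -!EFinB; congr EFin; lra.
Qed.

(** The integral of a nonnegative function is a supremum over the simple
    functions below it, whether it is measurable or not. *)
Lemma ge0_le_integral_nonmeasurable (D : set R) (f g : R -> \bar R) :
  (forall x, D x -> 0 <= f x) -> (forall x, D x -> f x <= g x) ->
  \int[mu]_(x in D) f x <= \int[mu]_(x in D) g x.
Proof.
move=> f0 fg; have g0 x : D x -> 0 <= g x by move=> Dx; rewrite (le_trans (f0 x Dx)) ?fg.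
rewrite !ge0_integralE//; apply: ereal_sup_le => _ [h hf <-]; exists h => // x.
apply: le_trans (hf x) _; rewrite !patchE; case: ifPn => // /[!inE].
exact: fg.
Qed.

(** Replacing g by 0 or by +oo on the exceptional set gives measurable functions
    lo <= f <= hi with the integral of g. *)
Lemma ge0_ae_eq_integral_nonmeasurable (D : set R) (f g : R -> \bar R) :
  measurable D -> measurable_fun D g ->
  (forall x, D x -> 0 <= f x) -> (forall x, D x -> 0 <= g x) ->
  {ae mu, forall x, D x -> f x = g x} ->
  \int[mu]_(x in D) f x = \int[mu]_(x in D) g x.
Proof.
move=> mD mg f0 g0 [N [mN N0 fgN]].
have fgE x : D x -> ~ N x -> f x = g x.
  by move=> Dx Nx; apply: contrapT => fgx; apply/Nx/fgN => /(_ Dx).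
pose lo x := if x \in N then 0 else g x.
pose hi x := if x \in N then +oo else g x.
have mif (c : \bar R) : measurable_fun D (fun x => if x \in N then c else g x).
  apply: measurable_fun_if => //.
  - apply: (measurable_fun_bool true).
    rewrite [X in measurable (_ `&` X)](_ : _ = N); first exact: measurableI.
    by apply/seteqP; split => x /=; [move/set_mem|move/mem_set].
  - exact: measurable_funS mg.
have ae_if (c : \bar R) : ae_eq mu D (fun x => if x \in N then c else g x) g.
  exists N; split => // x /= xN; apply: contrapT => Nx; apply: xN => _.
  by rewrite memNset.
apply/eqP; rewrite eq_le; apply/andP; split.
- rewrite -(@ge0_ae_eq_integral _ _ _ mu D hi g)//; last 3 first.
  exact: mif.
  by move=> x Dx; rewrite /hi; case: ifPn => // _; exact: g0.
  exact: ae_if.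
  apply: ge0_le_integral_nonmeasurable => // x Dx; rewrite /hi; case: ifPn => [_|]; first exact: leey.
  by move=> /negP; rewrite inE => Nx; rewrite fgE.
- rewrite -(@ge0_ae_eq_integral _ _ _ mu D lo g)//; last 3 first.
  exact: mif.
  by move=> x Dx; rewrite /lo; case: ifPn => // _; exact: g0.
  exact: ae_if.
  apply: ge0_le_integral_nonmeasurable => x Dx; rewrite /lo; case: ifPn => //.
  + by move=> _; exact: g0.
  + by move=> _; exact: f0.
  + by move=> /negP; rewrite inE => Nx; rewrite fgE.
Qed.

Lemma ae_reflection (T : R) (P : R -> Prop) :
  {ae mu, forall t, P t} -> {ae mu, forall t, P (T - t)%R}.
Proof.
move=> [N [mN N0 PN]]; exists ((fun t => T - t)%R @^-1` N); split.
- rewrite -[_ @^-1` _]setTI; apply: (_ : measurable_fun setT _) => //.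
  exact: measurable_reflection.
- by rewrite reflection_measure.
- by move=> t /= Pt; apply: PN.
Qed.

Lemma integral_reflection (T : R) (f : R -> \bar R) :
  measurable_fun setT f -> (forall t, 0 <= f t) ->
  \int[mu]_(t in `[0%R, T]) f (T - t)%R = \int[mu]_(t in `[0%R, T]) f t.
Proof.
move=> mf f0.
have DE : (fun t => T - t)%R @^-1` `[0%R, T]%classic = `[0%R, T]%classic :> set R.
  by apply/seteqP; split => x /=; rewrite !in_itv/= => /andP[? ?]; apply/andP; split; lra.
have mfT : measurable_fun `[0%R, T]%classic f by exact: measurable_funS mf.
have mT : measurable (`[0%R, T]%classic : set R) by [].
pose r : measurableTypeR R -> measurableTypeR R := (fun t => T - t)%R.
have mr : measurable_fun setT r by exact: measurable_reflection.
have := @ge0_integral_pushforward _ _ _ _ R r mr mu _ _ mT mfT (fun t _ => f0 t).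
rewrite DE => <-; apply: eq_measure_integral => /= A mA _.
exact: reflection_measure.
Qed.

End Integration.

(** * Derivatives of curves and Dini bounds *)

Section Calculus.
Context {R : realType}.

Lemma is_derive_chain (V W : normedModType R) (c : R -> V) (F : V -> W) (t : R) (v : V) :
  is_derive t 1 c v -> differentiable F (c t) -> is_derive t 1 (F \o c) ('d F (c t) v).
Proof.
move=> [/derivable1_diffP dc <-] dF.
have dFc : differentiable (F \o c) t by exact: differentiable_comp.
apply: DeriveDef; first exact: diff_derivable.
rewrite deriveE// diff_comp//=; congr ('d F _ _).
by rewrite deriveE.
Qed.

Lemma is_derive_pair (V W : normedModType R) (c : R -> V) (e : R -> W) (t : R) v w :
  is_derive t 1 c v -> is_derive t 1 e w ->
  is_derive t 1 (fun s => (c s, e s)) (v, w).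
Proof.
move=> [/derivable1_diffP dc <-] [/derivable1_diffP de <-].
have dce : differentiable (fun s => (c s, e s)) t by exact: differentiable_pair.
apply: DeriveDef; first exact: diff_derivable.
by rewrite deriveE// diff_pair// !deriveE.
Qed.

Lemma differentiable_mx (V : normedModType R) p q (f : V -> 'M[R]_(p, q)) x :
  (forall i j, differentiable (fun y => f y i j) x) -> differentiable f x.
Proof.
move=> df.
have -> : f = \sum_(i < p) \sum_(j < q) (fun y => f y i j *: delta_mx i j).
  apply/funext => y; rewrite fct_sumE [LHS]matrix_sum_delta; apply: eq_bigr => i _.
  by rewrite fct_sumE.
apply: differentiable_sum => i; apply: differentiable_sum => j.
exact: differentiableZl.
Qed.

Lemma differentiable_row p q (i : 'I_p) (x : 'M[R]_(p, q)) : differentiable (row i) x.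
Proof.
apply: differentiable_mx => a b; rewrite (_ : (fun y => _) = (fun y : 'M[R]_(p, q) => y i b)).
  exact: differentiable_coord.
by apply/funext => y; rewrite mxE.
Qed.

Lemma is_derive_mx p q (f : R -> 'M[R]_(p, q)) (t : R) v :
  is_derive t 1 f v <-> forall i j, is_derive t 1 (fun s => f s i j) (v i j).
Proof.
split=> [[df <-] i j|D].
  have /derivable_mxP df' := df.
  by apply: DeriveDef; [exact: df'|rewrite derive_mx// mxE].
have df : derivable f t 1 by apply/derivable_mxP => i j; have [] := D i j.
apply: DeriveDef => //; rewrite derive_mx//.
by apply/matrixP => i j; rewrite mxE; have [_ ->] := D i j.
Qed.

Lemma is_derive_rows p q (f : R -> 'M[R]_(p, q)) (t : R) v :
  is_derive t 1 f v <-> forall i, is_derive t 1 (fun s => row i (f s)) (row i v).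
Proof.
split=> [/is_derive_mx D i|D].
  apply/is_derive_mx => a b; rewrite mxE (_ : (fun s => _) = (fun s => f s i b)) //.
  by apply/funext => s; rewrite mxE.
apply/is_derive_mx => i j; have /is_derive_mx/(_ 0 j) := D i.
rewrite mxE (_ : (fun s => _) = (fun s => f s i j)) //.
by apply/funext => s; rewrite mxE.
Qed.

Lemma is_derive_line (V : normedModType R) (r v : V) (t : R) :
  is_derive t 1 (fun s : R => r + s *: v) v.
Proof.
have D : is_diff t (fun s : R => s *: v) (fun s => s *: v) by exact: is_diff_scalel.
rewrite -[v in X in is_derive _ _ _ X]add0r; apply: (@is_deriveD _ _ _ (cst r) (fun s : R => s *: v)).
apply: DeriveDef; first by apply: diff_derivable; exact: ex_diff.
by rewrite deriveE ?diff_val ?scale1r//; exact: ex_diff.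
Qed.

End Calculus.

Lemma is_derive_near (R : realType) (W : normedModType R) (f : R -> W) (t : R) (v : W) (e : R) :
  is_derive t 1 f v -> 0 < e ->
  \forall s \near t, `|f s - f t - (s - t) *: v| <= e * `|s - t|.
Proof.
move=> [df dv] e0; move: df; rewrite /derivable => /cvg_ex[l lP].
have lv : l = v by rewrite -dv /derive; apply/esym/cvg_lim.
move: lP; rewrite lv => /cvgrPdist_le /(_ _ e0); rewrite /dnbhs.
rewrite near_withinE => H.
have st0 : s - t @[s --> t] --> 0.
  by rewrite -[X in _ --> X](subrr t); apply: cvgB => //; exact: cvg_cst.
have H' : \forall s \near t, s - t != 0 ->
    `|v - (s - t)^-1 *: ((f \o shift t) ((s - t) *: 1) - f t)| <= e := st0 _ H.
apply: filterS H' => s /= Hs.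
have [->|st] := eqVneq s t; first by rewrite !subrr scale0r subr0 !normr0 mulr0.
have st' : s - t != 0 by rewrite subr_eq0.
have := Hs st'; rewrite /GRing.scale/= mulr1 subrK => h.
rewrite -(@ler_pM2l _ (`|s - t|^-1)) ?invr_gt0 ?normr_gt0//.
rewrite [leRHS]mulrCA mulVf ?normr_eq0// mulr1 -normfV -normrZ.
by rewrite scalerBr scalerA mulVf// scale1r -normrN opprB.
Qed.

Lemma is_derive_lipschitz (R : realType) (W : normedModType R) (f : R -> W) (t : R) (v : W) :
  is_derive t 1 f v ->
  \forall s \near t, `|f s - f t| <= (`|v| + 1) * `|s - t|.
Proof.
move=> /is_derive_near /(_ ltr01); apply: filterS => s h.
rewrite -[f s - f t](subrK ((s - t) *: v)) (le_trans (ler_normD _ _))//.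
by rewrite normrZ; lra.
Qed.

(** The set of the t with f t - e t <= f 0 contains its supremum c by
    continuity, and the Dini bound at c extends it beyond c unless c = 1. *)
Lemma upper_dini_le (R : realType) (f : R -> R) :
  (forall s : R, 0 <= s <= 1 -> {for s, continuous f}) ->
  (forall s e : R, 0 <= s <= 1 -> 0 < e -> \forall t \near s, f t - f s <= e * `|t - s|) ->
  f 1 <= f 0.
Proof.
move=> fc dini; apply/ler_addgt0Pr => e e0.
pose A := [set t | [/\ 0 <= t, t <= 1 & f t - e * t <= f 0]].
have A0 : A 0 by split; rewrite // mulr0 subr0.
have supA : has_sup A by split; [exists 0|exists 1 => t []].
pose c := sup A.
have c01 : 0 <= c <= 1.
  apply/andP; split; first by apply: ub_le_sup => //; case: supA.
  by apply: ge_sup; [exists 0|move=> t []].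
have Ac : f c - e * c <= f 0.
  rewrite leNgt; apply/negP => fc0.
  have gc : {for c, continuous (fun t => f t - e * t)}.
    apply: cvgB; first exact: fc.
    by apply: cvgM; [exact: cvg_cst|exact: cvg_id].
  have /nbhs_ballP[r /= r0 rP] : \forall t \near c, f 0 < f t - e * t.
    exact: (cvgr_gt _ gc).
  have [t At ct] := sup_adherent r0 supA.
  have tc : t <= c by apply: ub_le_sup => //; case: supA.
  have /rP : ball c r t by rewrite /ball/= ger0_norm ?subr_ge0// ltrBlDr -ltrBlDl.
  by case: At => _ _; rewrite leNgt => /negP.
have [c1|c1] := eqVneq c 1; first by move: Ac; rewrite c1; lra.
have {}c1 : c < 1 by rewrite lt_neqAle c1; case/andP: c01.
have /nbhs_ballP[r /= r0 rP] := dini c e c01 e0.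
pose t := c + Num.min (r / 2) (1 - c).
have d0 : 0 < Num.min (r / 2) (1 - c) by rewrite lt_min divr_gt0// subr_gt0.
have tc : c < t by rewrite ltrDl.
have At : A t.
  split.
  - by rewrite (le_trans _ (ltW tc))//; case/andP: c01.
  - by rewrite /t -lerBrDl ge_min lexx orbT.
  - have /rP : ball c r t.
      rewrite /ball/= distrC gtr0_norm ?subr_gt0// /t addrC addKr.
      by rewrite (@le_lt_trans _ _ (r / 2))// ?ge_min ?lexx//; lra.
    by rewrite gtr0_norm ?subr_gt0//; lra.
have : t <= c by apply: ub_le_sup => //; case: supA.
by rewrite leNgt tc.
Qed.

(** The Dini bound is two-sided in t, so t |-> f (1 - t) satisfies it too. *)
Lemma upper_dini_cst (R : realType) (f : R -> R) :
  (forall s : R, 0 <= s <= 1 -> {for s, continuous f}) ->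
  (forall s e : R, 0 <= s <= 1 -> 0 < e -> \forall t \near s, f t - f s <= e * `|t - s|) ->
  f 1 = f 0.
Proof.
move=> fc dini; apply/eqP; rewrite eq_le upper_dini_le//=.
have rc (s : R) : 1 - t @[t --> s] --> 1 - s.
  by apply: cvgB; [exact: cvg_cst|exact: cvg_id].
have := @upper_dini_le R (fun t => f (1 - t)); rewrite subrr subr0; apply.
- move=> s s01; apply: (@cvg_comp _ _ _ (fun t => 1 - t) f _ _ _ (rc s)).
  by apply: fc; lra.
- move=> s e s01 e0; have s01' : 0 <= 1 - s <= 1 by lra.
  have H : \forall t \near s, f (1 - t) - f (1 - s) <= e * `|(1 - t) - (1 - s)|.
    exact: (rc s _ (dini _ _ s01' e0)).
  apply: filterS H => t; rewrite (_ : (1 - t) - (1 - s) = s - t); last by lra.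
  by rewrite distrC.
Qed.

(** The limit of a divergent difference quotient is the default point. *)
Lemma derive1_not_derivable (R : realType) (V : normedModType R) (f : R -> V) (t : R) :
  ~ derivable f t 1 -> derive1 f t = point.
Proof.
rewrite /derivable /derive1 => h.
have -> : (fun h : R => h^-1 *: (f (h + t) - f t)) =
    (fun h => h^-1 *: ((f \o shift t) (h *: 1) - f t)).
  by apply/funext => x /=; rewrite /GRing.scale /= mulr1.
by rewrite dvgP.
Qed.

Lemma derive1_mx_not_derivable (R : realType) N d (f : R -> 'M[R]_(N, d)) (t : R) :
  ~ derivable f t 1 -> derive1 f t = 0.
Proof.
move=> /derive1_not_derivable ->.
transitivity ((\matrix_(i, j) point) : 'M[R]_(N, d)); first by [].
by apply/matrixP => i j; rewrite !mxE.
Qed.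

(** * The mass inner product, the Lagrangian and the action of curves *)

Section Mechanics.
Context {R : realType} {N d : nat}.
Variable m : 'I_N -> R.
Hypothesis m_gt0 : forall i, 0 < m i.
Notation mu := (@lebesgue_measure R).
Local Notation conf := 'M[R]_(N, d).
Implicit Types (x y v w : conf) (gamma beta p : R -> conf).

Lemma mass_dotE x y : mass_dot m x y = \sum_(i < N) \sum_(k < d) m i * (x i k * y i k).
Proof.
apply: eq_bigr => i _; rewrite /dotE mulr_sumr; apply: eq_bigr => k _.
by rewrite !mxE.
Qed.

Lemma mass_dotC x y : mass_dot m x y = mass_dot m y x.
Proof.
by rewrite !mass_dotE; apply: eq_bigr => i _; apply: eq_bigr => k _; rewrite [x i k * _]mulrC.
Qed.

Lemma mass_dotDl x y v : mass_dot m (x + y) v = mass_dot m x v + mass_dot m y v.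
Proof.
rewrite !mass_dotE -big_split; apply: eq_bigr => i _ /=.
by rewrite -big_split; apply: eq_bigr => k _ /=; rewrite mxE mulrDl mulrDr.
Qed.

Lemma mass_dotZl c x v : mass_dot m (c *: x) v = c * mass_dot m x v.
Proof.
rewrite !mass_dotE mulr_sumr; apply: eq_bigr => i _ /=.
by rewrite mulr_sumr; apply: eq_bigr => k _ /=; rewrite mxE; lra.
Qed.

Lemma mass_dotDr x y v : mass_dot m v (x + y) = mass_dot m v x + mass_dot m v y.
Proof. by rewrite mass_dotC mass_dotDl !(mass_dotC v). Qed.

Lemma mass_dotZr c x v : mass_dot m v (c *: x) = c * mass_dot m v x.
Proof. by rewrite mass_dotC mass_dotZl (mass_dotC v). Qed.

Lemma mass_dotNl x v : mass_dot m (- x) v = - mass_dot m x v.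
Proof. by rewrite -scaleN1r mass_dotZl mulN1r. Qed.

Lemma mass_dotNr x v : mass_dot m v (- x) = - mass_dot m v x.
Proof. by rewrite mass_dotC mass_dotNl mass_dotC. Qed.

Lemma mass_dot0l v : mass_dot m 0 v = 0.
Proof. by rewrite -(scale0r v) mass_dotZl mul0r. Qed.

Lemma mass_dot_ge0 x : 0 <= mass_dot m x x.
Proof.
rewrite mass_dotE; apply: sumr_ge0 => i _; apply: sumr_ge0 => k _.
by rewrite mulr_ge0 ?(ltW (m_gt0 i))// -expr2 sqr_ge0.
Qed.

Lemma mass_norm_sqr x : mass_norm m x ^+ 2 = mass_dot m x x.
Proof. by rewrite /mass_norm sqr_sqrtr// mass_dot_ge0. Qed.

Lemma mass_dot_entry x i k : m i * x i k ^+ 2 <= mass_dot m x x.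
Proof.
rewrite mass_dotE (bigD1 i)//= (bigD1 k)//= -expr2 -addrA lerDl addr_ge0//.
  by apply: sumr_ge0 => k' _; rewrite mulr_ge0 ?(ltW (m_gt0 i))// -expr2 sqr_ge0.
apply: sumr_ge0 => i' _; apply: sumr_ge0 => k' _.
by rewrite mulr_ge0 ?(ltW (m_gt0 i'))// -expr2 sqr_ge0.
Qed.

Lemma mass_dot_eq0 x : mass_dot m x x = 0 -> x = 0.
Proof.
move=> x0; apply/matrixP => i k; rewrite mxE; apply/eqP; rewrite -sqrf_eq0.
have := mass_dot_entry x i k; rewrite x0 pmulr_rle0// => h.
by rewrite eq_le h sqr_ge0.
Qed.

Lemma mass_dotB x y : mass_dot m (x - y) (x - y) =
  mass_dot m x x - 2 * mass_dot m x y + mass_dot m y y.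
Proof. by rewrite !mass_dotDl !mass_dotDr !mass_dotNl !mass_dotNr (mass_dotC y x); lra. Qed.

Lemma entry_le_norm x i k : `|x i k| <= `|x|.
Proof.
rewrite [leRHS]/Num.norm/= mx_normrE.
by apply/bigmax_geP; right; exists (i, k).
Qed.

Lemma norm_le_entries x c : 0 <= c -> (forall i k, `|x i k| <= c) -> `|x| <= c.
Proof.
by move=> c0 xc; rewrite [leLHS]/Num.norm/= mx_normrE; apply/bigmax_leP; split.
Qed.

(** Absolute continuity is measured with the sup norm of matrices, but the group
    acts by isometries of the mass norm: this lemma and the next one pass from
    one norm to the other. *)
Lemma norm_le_mass : exists2 c, 0 < c & forall x, `|x| <= c * mass_norm m x.
Proof.
exists (\sum_(i < N) Num.sqrt (m i)^-1 + 1).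
  by rewrite ltr_wpDl// sumr_ge0// => i _; rewrite sqrtr_ge0.
move=> x; apply: norm_le_entries.
  by rewrite mulr_ge0 ?sqrtr_ge0// addr_ge0// sumr_ge0// => i _; rewrite sqrtr_ge0.
move=> i k; have := mass_dot_entry x i k; rewrite -ler_pdivlMl// => h.
rewrite -sqrtr_sqr (le_trans (ler_wsqrtr h))// sqrtrM ?invr_ge0 ?(ltW (m_gt0 i))//.
apply: ler_wpM2r; first exact: sqrtr_ge0.
rewrite (bigD1 i)//= -addrA lerDl addr_ge0// sumr_ge0// => j _; exact: sqrtr_ge0.
Qed.

Lemma mass_le_norm : exists2 c, 0 < c & forall x, mass_dot m x x <= c * `|x| ^+ 2.
Proof.
exists (\sum_(i < N) \sum_(k < d) m i + 1).
  by rewrite ltr_wpDl// sumr_ge0// => i _; rewrite sumr_ge0// => k _; exact: ltW.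
move=> x; rewrite mulrDl mul1r -[leLHS]addr0 lerD ?sqr_ge0//.
rewrite mass_dotE mulr_suml; apply: ler_sum => i _.
rewrite mulr_suml; apply: ler_sum => k _.
by rewrite ler_pM2l// -expr2 -real_normK ?num_real// ler_sqr ?nnegrE// entry_le_norm.
Qed.

Lemma abs_continuous_entry a b gamma i k : abs_continuous a b gamma ->
  abs_cont_on a b (fun t => gamma t i k).
Proof.
move=> gAC eps /gAC[delta delta0 gdelta]; exists delta => // n s t st tI sumst.
apply: le_lt_trans (gdelta n s t st tI sumst); apply: ler_sum => j _.
by have := entry_le_norm (gamma (t j) - gamma (s j)) i k; rewrite !mxE.
Qed.

(** The pointwise derivative of gamma need not be a measurable function on the
    line; p is an integrable function that agrees with it almost everywhere. *)
Definition is_velocity (a b : R) gamma (p : R -> conf) :=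
  [/\ forall i k, mu.-integrable setT (fun t => (p t i k)%:E),
      forall i k (s t : R), a <= s -> s <= t -> t <= b ->
        \int[mu]_(r in `]s, t]) p r i k = gamma t i k - gamma s i k &
      {ae mu, forall t, a < t -> t < b -> is_derive t 1 gamma (p t)}].

Lemma velocity_exists a b gamma : a <= b -> abs_continuous a b gamma ->
  exists p, is_velocity a b gamma p.
Proof.
move=> ab gAC.
have /choice[h hP] (ik : 'I_N * 'I_d) := abs_cont_on_density ab
  (abs_continuous_entry ik.1 ik.2 gAC).
exists (fun t => \matrix_(i, k) h (i, k) t); split.
- move=> i k; have [hint _ _] := hP (i, k).
  by apply: eq_integrable hint => // t _; rewrite /= mxE.
- move=> i k x y ax xy yb; have [_ hE _] := hP (i, k).
  by rewrite -hE//; apply: eq_Rintegral => t _; rewrite mxE.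
- have : {ae mu, forall t, forall ik, a < t -> t < b ->
      is_derive t 1 (fun t => gamma t ik.1 ik.2) (h ik t)}.
    by apply: filter_forall => ik; have [_ _] := hP ik.
  apply: filterS; first exact: (ae_filter_ringOfSetsType mu).
  move=> t H at_ tb.
  have D i k : is_derive t 1 (fun t => gamma t i k) (h (i, k) t) by apply: (H (i, k)).
  have Dg : derivable gamma t 1 by apply/derivable_mxP => i k; have [] := D i k.
  apply: DeriveDef => //; rewrite derive_mx//.
  by apply/matrixP => i k; rewrite !mxE; have [_ ->] := D i k.
Qed.

(** Stopping gamma outside [a, b] makes its entries continuous, hence measurable,
    on the whole line. *)
Definition clamped (a b : R) gamma : R -> conf := gamma \o clamp a b.

Lemma clamped_entry_continuous a b gamma i k : a <= b -> abs_continuous a b gamma ->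
  continuous (fun t => clamped a b gamma t i k).
Proof.
move=> ab gAC.
by have := abs_cont_continuous (abs_cont_clamp ab (abs_continuous_entry i k gAC)).
Qed.

Lemma measurable_mass_dot (p q : R -> conf) :
  (forall i k, measurable_fun setT (fun t => p t i k)) ->
  (forall i k, measurable_fun setT (fun t => q t i k)) ->
  measurable_fun setT (fun t => mass_dot m (p t) (q t)).
Proof.
move=> mp mq; under eq_fun do rewrite mass_dotE.
apply: measurable_sum => i; apply: measurable_sum => k.
by apply: measurable_funM => //; exact: measurable_funM.
Qed.

Lemma measurable_potential gamma : (forall i k, measurable_fun setT (fun t => gamma t i k)) ->
  measurable_fun setT (fun t => potential m (gamma t)).
Proof.
move=> mg; apply: emeasurable_sum => i.
rewrite (_ : (fun t => _) = (fun t => \sum_(j < N) if (i < j)%N then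
    if row i (gamma t) == row j (gamma t) then +oo
     else (m i * m j / normE (row i (gamma t) - row j (gamma t)))%:E else 0)%E); last first.
  by apply/funext => t; rewrite big_mkcond.
apply: emeasurable_sum => j; have [_|_] := boolP (i < j)%N; last exact: measurable_cst.
pose q t := \sum_(k < d) (gamma t i k - gamma t j k) ^+ 2.
have mq : measurable_fun setT q.
  by apply: measurable_sum => k; apply: measurable_funX; exact: measurable_funB.
have q0 t : 0 <= q t by apply: sumr_ge0 => k _; rewrite sqr_ge0.
have dotq t : dotE (row i (gamma t) - row j (gamma t)) (row i (gamma t) - row j (gamma t)) = q t.
  by apply: eq_bigr => k _; rewrite !mxE expr2.
have qE t : (row i (gamma t) == row j (gamma t)) = (q t == 0).
  apply/eqP/eqP => [gij|/eqP].
    by rewrite -dotq gij subrr /dotE big1// => k _; rewrite mxE mul0r.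
  rewrite psumr_eq0; last by move=> k _; rewrite sqr_ge0.
  move=> /allP h; apply/rowP => k; have := h k (mem_index_enum k).
  by rewrite sqrf_eq0 subr_eq0 !mxE => /eqP.
(* a distance is a square root of q, and powR is a measurable function *)
rewrite (_ : (fun t => _) = (fun t => if q t == 0 then +oo%E else
    (m i * m j * powR (powR (q t) 2^-1) (-1))%:E)); last first.
  apply/funext => t; by rewrite qE powR_inv1 ?powR_ge0// powR12_sqrt// -dotq.
apply: measurable_fun_ifT => //.
  exact: measurable_fun_eqr.
apply/measurable_EFinP; apply: measurable_funM => //.
apply: (measurableT_comp (measurable_powR _)).
exact: (measurableT_comp (measurable_powR _)).
Qed.

Lemma mass_dot_CS (x y : conf) : mass_dot m x y <= mass_norm m x * mass_norm m y.
Proof.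
have [a0|a0] := eqVneq (mass_norm m x) 0.
  have /mass_dot_eq0 -> : mass_dot m x x = 0 by rewrite -mass_norm_sqr// a0 expr0n.
    by rewrite mass_dot0l mulr_ge0// sqrtr_ge0.
have [b0|b0] := eqVneq (mass_norm m y) 0.
  have /mass_dot_eq0 -> : mass_dot m y y = 0 by rewrite -mass_norm_sqr// b0 expr0n.
    by rewrite mass_dotC mass_dot0l mulr_ge0// sqrtr_ge0.
have ab0 : 0 < mass_norm m x * mass_norm m y.
  by rewrite mulr_gt0// lt_neqAle eq_sym ?a0 ?b0 sqrtr_ge0.
have := mass_dot_ge0 (mass_norm m y *: x - mass_norm m x *: y).
rewrite mass_dotB !mass_dotZl !mass_dotZr -!mass_norm_sqr//.
set a := mass_norm m x in ab0 *; set b := mass_norm m y in ab0 *.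
move=> h; rewrite -(ler_pM2l ab0); lra.
Qed.

Lemma is_derive_mass_dot (w : conf) (c : R -> conf) (t : R) v : is_derive t 1 c v ->
  is_derive t 1 (fun s => mass_dot m w (c s)) (mass_dot m w v).
Proof.
move=> /is_derive_mx D.
rewrite mass_dotE (_ : (fun s => _) =
    \sum_(i < N) \sum_(k < d) (fun s => (m i * w i k) *: c s i k)); last first.
  apply/funext => s; rewrite mass_dotE fct_sumE; apply: eq_bigr => i _.
  by rewrite fct_sumE; apply: eq_bigr => k _; rewrite mulrA.
apply: is_derive_sum => i; apply: is_derive_sum => k; rewrite mulrA.
exact: is_deriveZ.
Qed.

(** Mean value inequality: the mean value theorem is applied to the product of
    the curve with its own total increment. *)
Lemma mass_norm_curve (c : R -> conf) (c' : R -> conf) (a b K : R) : a <= b ->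
  (forall t, a <= t <= b -> is_derive t 1 c (c' t)) ->
  (forall t, a <= t <= b -> mass_norm m (c' t) <= K) ->
  mass_norm m (c b - c a) <= K * (b - a).
Proof.
rewrite le_eqVlt => /predU1P[<-|ab] Dc cK.
  by rewrite !subrr mulr0 /mass_norm mass_dot0l sqrtr0.
set w := c b - c a.
have D t : a <= t <= b -> is_derive t 1 (fun s => mass_dot m w (c s)) (mass_dot m w (c' t)).
  by move=> /Dc; exact: is_derive_mass_dot.
have [||t tab tE] := @MVT R (fun s => mass_dot m w (c s)) (fun t => mass_dot m w (c' t)) a b ab.
- by move=> t; rewrite in_itv/= => /andP[/ltW at_ /ltW tb]; apply: D; rewrite at_.
- apply: derivable_within_continuous => t; rewrite in_itv/= => /D []//.
have tab' : a <= t <= b by move: tab; rewrite in_itv/= => /andP[/ltW -> /ltW ->].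
have wE : mass_norm m w ^+ 2 = mass_dot m w (c' t) * (b - a).
  by rewrite mass_norm_sqr// {2}/w mass_dotDr mass_dotNr.
have [w0|w0] := eqVneq (mass_norm m w) 0.
  rewrite w0 mulr_ge0 ?subr_ge0 ?(ltW ab)//.
  by rewrite (le_trans _ (cK _ tab'))// sqrtr_ge0.
have wp : 0 < mass_norm m w by rewrite lt_neqAle eq_sym w0 sqrtr_ge0.
rewrite -(ler_pM2l wp) -expr2 wE mulrA ler_wpM2r ?subr_ge0 ?(ltW ab)//.
apply: le_trans (mass_dot_CS _ _) _.
by rewrite ler_wpM2l ?(ltW wp)// cK.
Qed.

Lemma normr_mass_dot x y : `|mass_dot m x y| <= mass_norm m x * mass_norm m y.
Proof.
rewrite ler_norml mass_dot_CS// andbT lerNl.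
have := mass_dot_CS x (- y).
by rewrite {2}/mass_norm !mass_dotNr mass_dotNl opprK.
Qed.

Lemma abs_continuous_le_increment a b C gamma beta : 0 <= C ->
  (forall s t, a <= s -> s <= t -> t <= b ->
    `|beta t - beta s| <= C * (t - s + `|gamma t - gamma s|)) ->
  abs_continuous a b gamma -> abs_continuous a b beta.
Proof.
move=> C0 lip gAC eps eps0.
have C1 : 0 < C + 1 by rewrite ltr_wpDl.
pose e := eps / (C + 1) / 2.
have e0 : 0 < e by rewrite !divr_gt0.
have [delta delta0 gdelta] := gAC _ e0.
exists (Num.min delta e); first by rewrite lt_min delta0.
move=> k s t st tI; rewrite lt_min => /andP[sd se].
apply: (@le_lt_trans _ _ (C * (\sum_(i < k) (t i - s i) +
    \sum_(i < k) `|gamma (t i) - gamma (s i)|))).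
  by rewrite -big_split mulr_sumr; apply: ler_sum => i _; have [] := st i; exact: lip.
apply: (@le_lt_trans _ _ (C * (e + e))).
  by rewrite ler_wpM2l// lerD// ltW// gdelta.
rewrite -splitr mulrA ltr_pdivrMr// mulrC ltr_pM2l//.
by rewrite ltrDl.
Qed.

Lemma abs_continuous_reverse T gamma : abs_continuous 0 T gamma ->
  abs_continuous 0 T (fun t => gamma (T - t)).
Proof.
move=> gAC eps /gAC[delta delta0 gdelta]; exists delta => // k s t st tI sumst.
under eq_bigr do rewrite distrC.
apply: (gdelta k (fun i => T - t i) (fun i => T - s i)).
- by move=> i; have [s0 st' tT] := st i; split; lra.
- move=> i j _ _ [x [/=]]; rewrite !in_itv/= => /andP[? ?] /andP[? ?].
  by apply: tI => //; exists (T - x); split; rewrite /= in_itv/=; apply/andP; split; lra.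
- by apply: le_lt_trans sumst; apply: ler_sum => i _; lra.
Qed.

Lemma lipschitz_abs_continuous a b C beta : 0 <= C ->
  (forall s t, a <= s -> s <= t -> t <= b -> `|beta t - beta s| <= C * (t - s)) ->
  abs_continuous a b beta.
Proof.
move=> C0 lip; apply: (@abs_continuous_le_increment _ _ C (cst 0)) => //.
  by move=> s t as_ st tb; rewrite subrr normr0 addr0; exact: lip.
move=> eps eps0; exists 1 => // k s t _ _ _.
by rewrite big1// => i _; rewrite subrr normr0.
Qed.

Lemma clamped_differentiable_continuous a b gamma (f : conf -> R) : a <= b ->
  abs_continuous a b gamma -> (forall x, differentiable f x) ->
  continuous (fun t => f (clamped a b gamma t)).
Proof.
move=> ab gAC df t; apply: (@continuous_comp _ _ _ (clamped a b gamma) f); last first.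
  exact: differentiable_continuous.
have gc i k := @clamped_entry_continuous _ _ _ i k ab gAC t.
apply/cvgrPdist_lt => eps eps0.
have : \forall s \near t, forall ik : 'I_N * 'I_d,
    `|clamped a b gamma t ik.1 ik.2 - clamped a b gamma s ik.1 ik.2| < eps / 2.
  apply: (@filter_forall R _ (fun (ik : 'I_N * 'I_d) s =>
    `|clamped a b gamma t ik.1 ik.2 - clamped a b gamma s ik.1 ik.2| < eps / 2)
    (nbhs t) _) => ik; have := gc ik.1 ik.2.
  by move/cvgrPdist_lt; apply; rewrite divr_gt0.
apply: filterS => s h; apply: (@le_lt_trans _ _ (eps / 2)); last first.
  by rewrite ltr_pdivrMr// ltr_pMr// ltr1n.
by apply: norm_le_entries => [|i k]; rewrite ?ltW ?divr_gt0// !mxE; have := h (i, k).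
Qed.

Lemma potential_ge0 (x : conf) : (0 <= potential m x)%E.
Proof.
apply: sume_ge0 => i _; apply: sume_ge0 => j _; case: ifP => // _.
by rewrite lee_fin; apply: divr_ge0; [rewrite mulr_ge0// ltW|exact: sqrtr_ge0].
Qed.

Lemma lagrangian_ge0 (x v : conf) : (0 <= lagrangian m x v)%E.
Proof. by rewrite adde_ge0 ?potential_ge0// lee_fin mulr_ge0 ?sqr_ge0. Qed.

Lemma lagrangianE (x v : conf) :
  lagrangian m x v = ((2^-1 * mass_dot m v v)%:E + potential m x)%E.
Proof. by rewrite /lagrangian mass_norm_sqr. Qed.

Lemma mass_norm_triangle (x y : conf) :
  mass_norm m (x + y) <= mass_norm m x + mass_norm m y.
Proof.
rewrite -ler_sqr ?nnegrE ?addr_ge0 ?sqrtr_ge0// sqrrD !mass_norm_sqr//.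
rewrite !mass_dotDl !mass_dotDr (mass_dotC y x).
by have := mass_dot_CS x y; lra.
Qed.

Lemma lagrangianN (x v : conf) : lagrangian m x (- v) = lagrangian m x v.
Proof. by rewrite !lagrangianE mass_dotNl mass_dotNr opprK. Qed.

Lemma measurable_lagrangian gamma (p : R -> conf) :
  (forall i k, measurable_fun setT (fun t => gamma t i k)) ->
  (forall i k, measurable_fun setT (fun t => p t i k)) ->
  measurable_fun setT (fun t => lagrangian m (gamma t) (p t)).
Proof.
move=> mg mp; under eq_fun do rewrite lagrangianE.
apply: emeasurable_funD; last exact: measurable_potential.
apply/measurable_EFinP; apply: measurable_funM => //.
exact: measurable_mass_dot.
Qed.

(** The integrand of the action involves the pointwise derivative and may fail
    to be measurable; the action is computed from any measurable F that agrees
    with it almost everywhere. *)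
Lemma action_ae (T : R) beta (F : R -> \bar R) :
  measurable_fun setT F -> (forall t, (0 <= F t)%E) ->
  {ae mu, forall t, 0 < t -> t < T ->
    lagrangian m (beta t) (derive1 beta t) = F t} ->
  action m 0 T beta = (\int[mu]_(t in `[0%R, T]) F t)%E.
Proof.
move=> mF F0 LF; apply: ge0_ae_eq_integral_nonmeasurable => //.
- exact: measurable_funS mF.
- by move=> t _; exact: lagrangian_ge0.
- have n0 (c : R) : {ae mu, forall t, t <> c}.
    exists [set c]; split => //; first exact: lebesgue_measure_set1.
    by move=> t /= /contrapT.
  move: LF (n0 0) (n0 T); apply: filterS3; first exact: (ae_filter_ringOfSetsType mu).
  move=> t LF /eqP t0 /eqP tT /=; rewrite in_itv/= => /andP[h1 h2].
  by apply: LF; rewrite lt_neqAle ?h1 ?h2 ?andbT// eq_sym.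
Qed.

Lemma velocity_measurable a b gamma p i k : is_velocity a b gamma p ->
  measurable_fun setT (fun t => p t i k).
Proof. by move=> [pint _ _]; apply/measurable_EFinP; exact: measurable_int (pint i k). Qed.

Lemma clamped_measurable a b gamma i k : a <= b -> abs_continuous a b gamma ->
  measurable_fun setT (fun t => clamped a b gamma t i k).
Proof.
move=> ab gAC; apply: continuous_measurable_fun.
exact: (@clamped_entry_continuous _ _ _ i k ab gAC).
Qed.

Lemma action_velocity (T : R) gamma p : 0 < T -> abs_continuous 0 T gamma ->
  is_velocity 0 T gamma p ->
  action m 0 T gamma =
    (\int[mu]_(t in `[0%R, T]) lagrangian m (clamped 0 T gamma t) (p t))%E.
Proof.
move=> T0 gAC pv; apply: action_ae.
- apply: measurable_lagrangian => i k; first exact: clamped_measurable (ltW T0) gAC.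
  exact: velocity_measurable pv.
- by move=> t; exact: lagrangian_ge0.
- case: pv => _ _ ; apply: filterS; first exact: (ae_filter_ringOfSetsType mu).
  move=> t D t0 tT; rewrite derive1E /clamped/= clamp_id ?ltW ?t0//.
  by have [_ ->] := D t0 tT.
Qed.

Lemma integrable_velocity_dot a b gamma p (w : conf) : is_velocity a b gamma p ->
  mu.-integrable setT (fun t => (mass_dot m (p t) w)%:E).
Proof.
move=> [pint _ _].
rewrite (_ : (fun t => _) =
    (fun t => \sum_(i < N) \sum_(k < d) (m i * w i k)%:E * (p t i k)%:E)%E); last first.
  apply/funext => t; rewrite mass_dotE -sumEFin; apply: eq_bigr => i _.
  rewrite -sumEFin; apply: eq_bigr => k _; rewrite -EFinM; congr EFin.
  by rewrite [p t i k * _]mulrC mulrA.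
apply: integrable_sum => // i _; apply: integrable_sum => // k _.
by apply: integrableZl => //; exact: pint.
Qed.

Lemma integral_velocity_dot a b gamma p (w : conf) s t : is_velocity a b gamma p ->
  a <= s -> s <= t -> t <= b ->
  \int[mu]_(r in `]s, t]) mass_dot m (p r) w = mass_dot m (gamma t - gamma s) w.
Proof.
move=> [pint pE _] as_ st tb.
have pI i k : mu.-integrable `]s, t] (fun r => (p r i k)%:E).
  exact: integrableS (pint i k).
have pZ i k : mu.-integrable `]s, t] (fun r => (m i * w i k)%:E * (p r i k)%:E)%E.
  exact: integrableZl.
rewrite /Rintegral.
rewrite [X in fine X](_ : _ = (\sum_(i < N) \sum_(k < d)
    (m i * w i k * (gamma t i k - gamma s i k))%:E)%E).
  under eq_bigr do rewrite sumEFin; rewrite sumEFin /= mass_dotE.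
  apply: eq_bigr => i _; apply: eq_bigr => k _.
  by rewrite !mxE [RHS]mulrA mulrAC.
transitivity (\int[mu]_(r in `]s, t]) (\sum_(i < N) \sum_(k < d)
    ((m i * w i k)%:E * (p r i k)%:E)))%E.
  apply: eq_integral => r _; rewrite mass_dotE -sumEFin; apply: eq_bigr => i _.
  rewrite -sumEFin; apply: eq_bigr => k _; rewrite -EFinM; congr EFin.
  by rewrite [p r i k * _]mulrC mulrA.
rewrite integral_sum//; last by move=> i; apply: integrable_sum => // k _; exact: pZ.
apply: eq_bigr => i _; rewrite (integral_sum _ (pZ i))//.
apply: eq_bigr => k _; rewrite (integralZl _ (pI i k))//.
by rewrite [RHS]EFinM -pE// /Rintegral fineK//; apply: integrable_fin_num => //; exact: pI.
Qed.

Definition collision_free x := forall i j : 'I_N, (i < j)%N -> row i x != row j x.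

Lemma potential_fin_collision_free x : (potential m x < +oo)%E -> collision_free x.
Proof.
move=> Ux i j ij; apply/negP => /eqP xij; move: Ux; rewrite ltNge => /negP; apply.
have pos i' j' : (0 <= if row i' x == row j' x then +oo
    else (m i' * m j' / normE (row i' x - row j' x))%:E)%E.
  case: ifP => // _; rewrite lee_fin; apply: divr_ge0; last exact: sqrtr_ge0.
  by rewrite mulr_ge0// ltW.
rewrite /potential (bigD1 i)//= (bigD1 j)//= xij eqxx -addeA; apply: leeDl.
apply: adde_ge0; first by apply: sume_ge0 => j' _; rewrite -xij.
by apply: sume_ge0 => i' _; apply: sume_ge0 => j' _.
Qed.

Lemma normE_entry (r : 'rV[R]_d) k : `|r 0 k| <= normE r.
Proof.
rewrite -sqrtr_sqr; apply: ler_wsqrtr; rewrite /dotE (bigD1 k)//= -expr2 lerDl.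
by apply: sumr_ge0 => j _; rewrite -expr2 sqr_ge0.
Qed.

(** Two bodies that are apart at x differ in some coordinate, by c say, and this
    coordinate still keeps them c / 2 apart near x. *)
Lemma potential_bounded_near x : collision_free x ->
  exists2 B : R, 0 <= B & \forall y \near x, (potential m y <= B%:E)%E.
Proof.
move=> xcf.
have pair (ij : 'I_N * 'I_N) : exists B : R, 0 <= B /\ \forall y \near x, (ij.1 < ij.2)%N ->
    ((if row ij.1 y == row ij.2 y then +oo
      else (m ij.1 * m ij.2 / normE (row ij.1 y - row ij.2 y))%:E) <= B%:E)%E.
  case: ij => i j /=; case: (boolP (i < j)%N) => ij; last first.
    by exists 0; split => //; apply: (@filterE conf (nbhs x)) => y.
  have [k xk] : exists k, x i k != x j k.
    apply: contrapT => /forallNP h; move/negP: (xcf i j ij); apply.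
    by apply/eqP/rowP => k; rewrite !mxE; apply/eqP/negPn/negP; exact: h.
  pose c := `|x i k - x j k|; have c0 : 0 < c by rewrite normr_gt0 subr_eq0.
  exists (m i * m j / (c / 2)); split.
    by rewrite divr_ge0 ?mulr_ge0 ?ltW// divr_gt0.
  have cont : (fun y : conf => y i k - y j k) @ x --> x i k - x j k.
    exact: (cvgB (@coord_continuous R N d i k x) (@coord_continuous R N d j k x)).
  have c2 : 0 < c / 2 by rewrite divr_gt0.
  have H : nbhs x (fun y : conf => `|x i k - x j k - (y i k - y j k)| < c / 2).
    by move/cvgrPdist_lt : cont; apply.
  apply: filterS H => y yx _.
  have yc : c / 2 < `|y i k - y j k|.
    have := ler_normD (x i k - x j k - (y i k - y j k)) (y i k - y j k).
    by rewrite subrK -/c; lra.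
  have cn : c / 2 <= normE (row i y - row j y).
    apply: le_trans (ltW yc) _.
    by have := normE_entry (row i y - row j y) k; rewrite !mxE.
  case: eqP => [E|_].
    exfalso; move: yc; have /rowP/(_ k) := E; rewrite !mxE => ->.
    by rewrite subrr normr0; lra.
  rewrite lee_fin; apply: ler_wpM2l; first by rewrite mulr_ge0 ?ltW.
  by rewrite lef_pV2// posrE// (lt_le_trans c2).
have [B BP] := choice pair.
exists (\sum_(i < N) \sum_(j < N | (i < j)%N) B (i, j)).
  by apply: sumr_ge0 => i _; apply: sumr_ge0 => j _; have [] := BP (i, j).
have H : nbhs x (fun y : conf => forall ij : 'I_N * 'I_N, (ij.1 < ij.2)%N ->
    ((if row ij.1 y == row ij.2 y then +oo
      else (m ij.1 * m ij.2 / normE (row ij.1 y - row ij.2 y))%:E) <= (B ij)%:E)%E).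
  apply: (@filter_forall conf _ (fun (ij : 'I_N * 'I_N) (y : conf) => (ij.1 < ij.2)%N ->
    ((if row ij.1 y == row ij.2 y then +oo
      else (m ij.1 * m ij.2 / normE (row ij.1 y - row ij.2 y))%:E) <= (B ij)%:E)%E) (nbhs x) _).
  by move=> ij; have [] := BP ij.
apply: filterS H => y yB; rewrite /potential -sumEFin; apply: lee_sum => i _.
by rewrite -sumEFin; apply: lee_sum => j ij; exact: (yB (i, j)).
Qed.

(** The segment from y to z, run at unit speed, stays in a ball where the
    potential is at most B, so its action is at most a constant times its
    length. *)
Lemma dominated_lipschitz (u : conf -> R) x : dominated m u -> collision_free x ->
  exists K r : R, [/\ 0 <= K, 0 < r & forall y z, `|x - y| < r -> `|x - z| < r ->
    u z - u y <= K * `|z - y|].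
Proof.
move=> domu xcf.
have [B B0 /nbhs_ballP[r /= r0 UB]] := potential_bounded_near xcf.
have [C C0 massC] := mass_le_norm.
pose K := 2^-1 * C + B.
have K0 : 0 <= K by rewrite addr_ge0// mulr_ge0// ltW.
exists K, r; split => // y z xy xz.
have [->|yz] := eqVneq z y; first by rewrite !subrr normr0 mulr0.
pose l := `|z - y|; have l0 : 0 < l by rewrite normr_gt0 subr_eq0.
pose w := l^-1 *: (z - y); pose gamma (t : R) := y + t *: w.
have w1 : `|w| = 1 by rewrite /w normrZ gtr0_norm ?invr_gt0// mulVf// gt_eqF.
have Dg (t : R) : is_derive t 1 gamma w by exact: is_derive_line.
have gAC : abs_continuous 0 l gamma.
  apply: (@lipschitz_abs_continuous _ _ 1) => // s t _ st _.
  rewrite /gamma opprD addrACA subrr add0r -scalerBl normrZ w1 mulr1 mul1r.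
  by rewrite ger0_norm// subr_ge0.
have gl : gamma l = z.
  by rewrite /gamma /w scalerA mulfV ?gt_eqF// scale1r addrC subrK.
have g0 : gamma 0 = y by rewrite /gamma scale0r addr0.
have gball t : 0 <= t <= l -> `|x - gamma t| < r.
  move=> /andP[t0 tl]; have tl1 : t / l <= 1 by rewrite ler_pdivrMr// mul1r.
  have tl0 : 0 <= t / l by rewrite divr_ge0// ltW.
  have -> : x - gamma t = (1 - t / l) *: (x - y) + (t / l) *: (x - z).
    rewrite /gamma /w scalerA scalerBl scale1r !scalerBr.
    apply/matrixP => i k; rewrite !mxE; lra.
  apply: le_lt_trans (ler_normD _ _) _; rewrite [X in X + _]normrZ [X in _ + X]normrZ.
  rewrite [`|1 - _|]ger0_norm ?subr_ge0// [`|t / l|]ger0_norm//.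
  move: (t / l) tl1 tl0 => a a1 a0.
  have h1 : (1 - a) * `|x - y| <= (1 - a) * Num.max `|x - y| `|x - z|.
    by rewrite ler_wpM2l ?subr_ge0// le_max lexx.
  have h2 : a * `|x - z| <= a * Num.max `|x - y| `|x - z|.
    by rewrite ler_wpM2l// le_max lexx orbT.
  have h3 : Num.max `|x - y| `|x - z| < r by rewrite gt_max xy.
  by lra.
suff : ((u (gamma l) - u (gamma 0))%:E <= (K * l)%:E)%E.
  by rewrite gl g0 lee_fin.
apply: le_trans (domu (gamma 0) (gamma l)) _.
apply: (@le_trans _ _ (action m 0 l gamma)).
  by apply: ereal_inf_lbound; exists 0, l, gamma.
apply: (@le_trans _ _ (\int[mu]_(t in `[0%R, l]) K%:E)%E).
  apply: ge0_le_integral_nonmeasurable => t; first by move=> _; exact: lagrangian_ge0.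
  rewrite /= in_itv/= => tl; rewrite lagrangianE// derive1E.
  have [_ ->] := Dg t; rewrite EFinD; apply: leeD.
    rewrite lee_fin ler_pM2l// (le_trans (massC w))// w1 expr1n mulr1//.
  by apply: UB; rewrite -ball_normE/=; exact: gball.
by rewrite integral_cst//= lebesgue_measure_itv/= lte_fin l0 -EFinB -EFinM lee_fin subr0.
Qed.

End Mechanics.

(** The hypothesis is tested at e = I / (|Q| + 1), where the linear term
    dominates. *)
Lemma linear_le_quadratic (R : realType) (I Q : R) :
  (forall e, e * I <= e ^+ 2 / 2 * Q) -> I = 0.
Proof.
move=> h; have Q0 : 0 <= `|Q| by [].
have := h (I / (`|Q| + 1)).
have P : 0 < `|Q| + 1 by rewrite ltr_wpDl.
have QQ := ler_norm Q.
set e := I / (`|Q| + 1); have IE : I = e * (`|Q| + 1) by rewrite /e mulfVK// gt_eqF.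
move: e IE => e IE.
have [e0|e0] := eqVneq e 0; first by rewrite e0 mul0r in IE.
have e2 : 0 < e ^+ 2 by rewrite lt_neqAle sqr_ge0 eq_sym sqrf_eq0 e0.
by rewrite {1}IE mulrCA [e * (e * _)]mulrA -expr2 -mulrA ler_pM2l//; lra.
Qed.

(** * The action of the group and its infinitesimal generators *)

Section Symmetry.
Context {R : realType} {n d : nat} {G : pretopGroupType}.
Variables (A : set (chart 'rV[R]_n G)) (act : G -> 'rV[R]_d -> 'rV[R]_d).
Hypotheses (hG : is_lie_group A) (hact : is_smooth_action A act).
Implicit Types (c : chart 'rV[R]_n G) (g h : G).

Lemma act1 r : act 1%g r = r.
Proof. by case: hact. Qed.

Lemma actM g h r : act (g * h)%g r = act g (act h r).
Proof. by case: hact. Qed.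

Definition chart_act c (z : 'rV[R]_n * 'rV[R]_d) := act (param c z.1) z.2.

Lemma atlas_chart c : A c -> is_chart c.
Proof. by case: hG => _ _ [+ _ _] _ _; apply. Qed.

Lemma atlas_cover g : exists2 c, A c & dom c g.
Proof. by case: hG => _ _ [_ + _] _ _; apply. Qed.

Lemma chartK c g : A c -> dom c g -> param c (chart_map c g) = g.
Proof. by move=> /atlas_chart[_ _ + _ _]; apply. Qed.

Lemma chart_act_Ck c k : A c ->
  Ck_on k (chart_map c @` dom c `*` setT) (chart_act c).
Proof.
move=> Ac; case: hact => _ _ [_ /(_ (prod_chart c (id_chart 'rV[R]_d)) (id_chart _))].
have cP : prod_atlas A [set id_chart 'rV[R]_d] (prod_chart c (id_chart 'rV_d)).
  by exists c, (id_chart _).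
move=> /(_ cP erefl k) /=.
rewrite (_ : _ @` _ = chart_map c @` dom c `*` setT)//.
apply/seteqP; split => [z /= [[g r] [[/= cg _] _] <-]|[z r] /= [[g cg <-] _]].
  by split => //; exists g.
by exists (g, r).
Qed.

Lemma chart_act_diff c g r : A c -> dom c g ->
  differentiable (chart_act c) (chart_map c g, r).
Proof.
by move=> Ac cg; have [+ _] := chart_act_Ck 1 Ac; apply; split => //=; exists g.
Qed.

Lemma act_diff g r : differentiable (act g) r.
Proof.
have [c Ac cg] := atlas_cover g.
rewrite (_ : act g = chart_act c \o (fun r => (chart_map c g, r))).
  apply: differentiable_comp; last exact: chart_act_diff.
  by apply: differentiable_pair.
by apply/funext => r' /=; rewrite /chart_act/= chartK.
Qed.

Variables (c1 : chart 'rV[R]_n G) (ex : 'rV[R]_n -> G).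
Hypotheses (hc1 : A c1) (hc1dom : dom c1 1%g) (hexp : is_exponential A c1 ex).

Lemma expD xi (s t : R) : ex ((s + t) *: xi) = (ex (s *: xi) * ex (t *: xi))%g.
Proof. by case: (hexp xi). Qed.

Lemma exp0 : ex 0 = 1%g.
Proof.
have := expD 0 0 0; rewrite addr0 scale0r => h.
by apply: (mulgI (ex 0)); rewrite -h mulg1.
Qed.

Lemma exp_continuous xi : continuous (fun t : R => ex (t *: xi)).
Proof. by case: (hexp xi) => -[]. Qed.

Lemma exp_near1 xi : \forall h \near 0, dom c1 (ex (h *: xi)).
Proof.
have [c1open _ _ _ _] := atlas_chart hc1.
have := @exp_continuous xi 0 (dom c1); apply.
by apply: open_nbhs_nbhs; split => //; rewrite scale0r exp0.
Qed.

Lemma exp_derive xi : is_derive (0 : R) 1 (fun t : R => chart_map c1 (ex (t *: xi))) xi.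
Proof. by case: (hexp xi). Qed.

Let z1 := chart_map c1 1%g.

(** The generator on a single body, as a partial differential of the action in
    the chart c1: this form makes it linear in xi and differentiable in r. *)
Definition chart_generator (xi : 'rV[R]_n) r : 'rV[R]_d := 'd (chart_act c1) (z1, r) (xi, 0).

Lemma chart_act1 r : chart_act c1 (z1, r) = r.
Proof. by rewrite /chart_act/= chartK// act1. Qed.

Lemma diff_chart_act xi r v :
  'd (chart_act c1) (z1, r) (xi, v) = chart_generator xi r + v.
Proof.
rewrite (_ : (xi, v) = (xi, 0) + (0, v)); last first.
  by congr pair; rewrite ?addr0 ?add0r.
rewrite linearD; congr (_ + _).
have D : is_derive (0 : R) 1 (fun t : R => r + t *: v) v.
  exact: is_derive_line.
have Dpair := is_derive_pair (is_derive_cst z1 (0 : R) 1) D.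
have := is_derive_chain Dpair; rewrite scale0r addr0 => /(_ _ _ (chart_act_diff r hc1 hc1dom)).
rewrite (_ : _ \o _ = (fun t : R => r + t *: v)); last first.
  by apply/funext => t /=; exact: chart_act1.
by move=> [_ <-]; case: D.
Qed.

(** The subgroup passes through 1 at time s = t, where the differential of the
    action splits into its partial differentials. *)
Lemma act_exp_derive xi (t : R) (y : R -> 'rV[R]_d) v : is_derive t 1 y v ->
  is_derive t 1 (fun s => act (ex ((s - t) *: xi)) (y s)) (chart_generator xi (y t) + v).
Proof.
move=> Dy.
have De : is_derive t 1 (fun s => chart_map c1 (ex ((s - t) *: xi))) xi.
  have [/derivable1_diffP De0 Dv] := exp_derive xi.
  have De0' : differentiable (fun t : R => chart_map c1 (ex (t *: xi))) (shift (- t) t).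
    by rewrite /= subrr.
  have := is_derive_chain (is_derive_shift t 1 (- t)) De0'.
  by rewrite /= subrr -deriveE// Dv.
have := is_derive_chain (is_derive_pair De Dy).
rewrite subrr scale0r exp0 => /(_ _ _ (chart_act_diff _ hc1 hc1dom)).
rewrite diff_chart_act; apply: near_eq_is_derive.
have near_t : \forall s \near t, dom c1 (ex ((s - t) *: xi)).
  have st0 : s - t @[s --> t] --> 0.
    by rewrite -[X in _ --> X](subrr t); apply: cvgB => //; exact: cvg_cst.
  exact: (st0 _ (exp_near1 xi)).
near=> s; rewrite /= /chart_act/= chartK//; near: s; exact: near_t.
Unshelve. all: by end_near. Qed.

Lemma chart_generator_derive xi r :
  is_derive (0 : R) 1 (fun t : R => act (ex (t *: xi)) r) (chart_generator xi r).
Proof.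
have := act_exp_derive xi (is_derive_cst r (0 : R) 1).
by rewrite addr0; under eq_fun do rewrite subr0.
Qed.

(** The generator is a partial derivative of the action, which is of class
    C^2. *)
Lemma chart_generator_diff xi r : differentiable (chart_generator xi) r.
Proof.
have [_ /(_ (xi, 0))] := chart_act_Ck 2 hc1.
move=> [+ _] => /(_ (z1, r)) D.
rewrite (_ : chart_generator xi = (fun z => 'd (chart_act c1) z (xi, 0)) \o (fun r => (z1, r)))//.
apply: differentiable_comp; first exact: differentiable_pair.
by apply: D; split => //=; exists 1%g.
Qed.

(** Writing param c (q s) = P s as (P s * g0^-1) * g0, with g0 = P t, one gets a
    path through 1 at s = t; zeta is the velocity of that path in c1. It is the
    same for all r. *)
Lemma path_velocity c (q : R -> 'rV[R]_n) (t : R) v : A c ->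
  is_derive t 1 q v -> (\forall s \near t, (chart_map c @` dom c) (q s)) ->
  exists zeta, forall r, is_derive t 1 (fun s => act (param c (q s)) r)
    (chart_generator zeta (act (param c (q t)) r)).
Proof.
move=> Ac Dq nearq.
pose P s := param c (q s); pose g0 := P t.
have cqt : (chart_map c @` dom c) (q t).
  exact: (@nbhs_singleton _ t (fun s => (chart_map c @` dom c) (q s))) nearq.
have [g0' cg0' qt] := cqt.
have g0E : g0 = g0' by rewrite /g0 /P -qt chartK.
rewrite -{}g0E in cg0' qt; clear g0'.
have [c' Ac' c'g] := atlas_cover (g0^-1)%g.
case: hG => _ _ _ [mul_cont mul_smooth] _.
have aP : prod_atlas A A (prod_chart c c') by exists c, c'.
have [+ _] := mul_smooth _ _ aP hc1 1.
move=> /(_ (chart_map c g0, chart_map c' (g0^-1)%g)) DF.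
have {DF} : differentiable (chart_map c1 \o (fun p : G * G => (p.1 * p.2)%g) \o param (prod_chart c c'))
    (q t, chart_map c' (g0^-1)%g).
  rewrite -qt; apply: DF; exists (g0, (g0^-1)%g) => //=.
  by split => //; rewrite /= mulgV.
move=> DF; have := is_derive_chain (is_derive_pair Dq (is_derive_cst (chart_map c' (g0^-1)%g) t 1)) DF.
set zeta := 'd _ _ _ => Dz; exists zeta => r.
have {}Dz : is_derive t 1 (fun s => chart_map c1 (P s * g0^-1)%g) zeta.
  move: Dz; congr is_derive; apply/funext => s.
  by rewrite /= chartK.
have := is_derive_chain (is_derive_pair Dz (is_derive_cst (act g0 r) t 1)).
rewrite mulgV => /(_ _ _ (chart_act_diff _ hc1 hc1dom)).
rewrite diff_chart_act addr0; apply: near_eq_is_derive.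
have Pcont : P s @[s --> t] --> g0.
  have [_ _ _ _ pcont] := atlas_chart Ac.
  apply: (@continuous_comp _ _ _ q (param c)).
    by apply: differentiable_continuous; case: Dq => /derivable1_diffP.
  exact: pcont.
have near_t : \forall s \near t, dom c1 (P s * g0^-1)%g.
  have [c1open _ _ _ _] := atlas_chart hc1.
  have m1 : (fun p : G * G => (p.1 * p.2)%g) (P s, g0^-1)%g @[s --> t] --> 1%g.
    rewrite -(mulgV g0); apply: (@cvg_comp _ _ _ (fun s => (P s, g0^-1)%g) _ _ _ _ _ (mul_cont (g0, g0^-1)%g)).
    by apply: cvg_pair => //; exact: cvg_cst.
  by apply: (m1 (dom c1)); apply: open_nbhs_nbhs.
near=> s; rewrite /= /chart_act/= chartK//; last by near: s; exact: near_t.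
by rewrite -actM mulgVK.
Unshelve. all: by end_near. Qed.

Context {N : nat}.
Variable m : 'I_N -> R.
Hypothesis m_gt0 : forall i, 0 < m i.
Hypotheses (hL : lagrangian_invariant m act) (hiso : lift_isometric m act).
Notation mu := (@lebesgue_measure R).
Local Notation conf := 'M[R]_(N, d).
Implicit Types (x y v w : conf) (gamma p : R -> conf).
Local Notation S := (@diag_act R N d G act).
Local Notation X := (@generator R n N d G act ex).

Lemma row_diag_act g x i : row i (S g x) = act g (row i x).
Proof. by rewrite rowK. Qed.

Lemma diag_act1 x : S 1%g x = x.
Proof. by apply/row_matrixP => i; rewrite row_diag_act act1. Qed.

Lemma diag_actM g h x : S (g * h)%g x = S g (S h x).
Proof. by apply/row_matrixP => i; rewrite !row_diag_act actM. Qed.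

Lemma diag_act_diff g x : differentiable (S g) x.
Proof.
apply: differentiable_mx => i k.
rewrite (_ : (fun y => _) = (fun r : 'rV[R]_d => r 0 k) \o (act g \o row i)); last first.
  by apply/funext => y /=; rewrite mxE.
apply: differentiable_comp; last exact: differentiable_coord.
apply: differentiable_comp; first exact: differentiable_row.
exact: act_diff.
Qed.

Lemma generatorE xi x : X xi x = \matrix_i chart_generator xi (row i x).
Proof.
have D : is_derive (0 : R) 1 (fun t : R => S (ex (t *: xi)) x)
    (\matrix_i chart_generator xi (row i x)).
  apply/is_derive_rows => i; rewrite rowK; under eq_fun do rewrite row_diag_act.
  exact: chart_generator_derive.
by rewrite /generator derive1E; case: D.
Qed.

Lemma row_generator xi x i : row i (X xi x) = chart_generator xi (row i x).
Proof. by rewrite generatorE rowK. Qed.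

Lemma generator_diff xi x : differentiable (X xi) x.
Proof.
apply: differentiable_mx => i k.
rewrite (_ : (fun y => _) = (fun r : 'rV[R]_d => r 0 k) \o (chart_generator xi \o row i)); last first.
  by apply/funext => y /=; rewrite -row_generator mxE.
apply: differentiable_comp; last exact: differentiable_coord.
apply: differentiable_comp; first exact: differentiable_row.
exact: chart_generator_diff.
Qed.

Lemma diag_exp_derive xi (t : R) (y : R -> conf) v : is_derive t 1 y v ->
  is_derive t 1 (fun s => S (ex ((s - t) *: xi)) (y s)) (X xi (y t) + v).
Proof.
move=> /is_derive_rows Dy; apply/is_derive_rows => i.
rewrite linearD/= row_generator; under eq_fun do rewrite row_diag_act.
exact: act_exp_derive.
Qed.

Lemma diag_path_velocity c (q : R -> 'rV[R]_n) (t : R) (v : 'rV[R]_n) : A c ->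
  is_derive t 1 q v -> (\forall s \near t, (chart_map c @` dom c) (q s)) ->
  exists zeta, forall x, is_derive t 1 (fun s => S (param c (q s)) x)
    (X zeta (S (param c (q t)) x)).
Proof.
move=> Ac Dq qc.
have [zeta D] := path_velocity Ac Dq qc.
exists zeta => x; apply/is_derive_rows => i.
by rewrite row_generator row_diag_act; under eq_fun do rewrite row_diag_act.
Qed.

(** The exponential at time s is split as exp (t xi) * exp ((s - t) xi), so that
    the factor that depends on s is at 1 for s = t. *)
Lemma deformation_derive g xi (t : R) (y : R -> conf) v : is_derive t 1 y v ->
  is_derive t 1 (fun s => S g (S (ex (s *: xi)) (y s)))
    ('d (S (g * ex (t *: xi))%g) (y t) (X xi (y t) + v)).
Proof.
move=> Dy; have D := diag_exp_derive xi Dy.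
have := is_derive_chain D (diag_act_diff (g * ex (t *: xi))%g _).
rewrite subrr scale0r exp0 diag_act1.
congr is_derive; apply/funext => s /=.
by rewrite diag_actM; congr (diag_act act g _); rewrite -diag_actM -expD addrC subrK.
Qed.

(** The differential of S_g preserves mass norms, hence S_g does not increase
    the length of the segment from y to x. *)
Lemma diag_act_isometry g x y : mass_norm m (S g x - S g y) <= mass_norm m (x - y).
Proof.
have D (t : R) : is_derive t 1 (S g \o (fun s : R => y + s *: (x - y)))
    ('d (S g) (y + t *: (x - y)) (x - y)).
  by apply: is_derive_chain (diag_act_diff g _); exact: is_derive_line.
have := @mass_norm_curve _ _ _ m m_gt0 _ _ 0 1 (mass_norm m (x - y)) ler01 (fun t _ => D t).
rewrite /= scale1r scale0r addr0 [y + _]addrC subrK subr0 mulr1; apply => t _.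
by rewrite /mass_norm hiso.
Qed.

(** The orbit has the speed of its starting point at all times, since its
    velocity at time q is the image of X_xi x by the differential of an
    isometry. *)
Lemma flow_speed xi x (s t : R) : s <= t ->
  mass_norm m (S (ex (t *: xi)) x - S (ex (s *: xi)) x) <= mass_norm m (X xi x) * (t - s).
Proof.
move=> st.
apply: (@mass_norm_curve _ _ _ m m_gt0 (fun q : R => S (ex (q *: xi)) x)
    (fun q : R => 'd (S (1 * ex (q *: xi))%g) x (X xi x + 0)) _ _ _ st) => q _.
  have := deformation_derive 1%g xi (is_derive_cst x q 1).
  by under eq_fun do rewrite diag_act1.
by rewrite addr0 /mass_norm hiso.
Qed.

(** * The action of deformed curves *)

Lemma generatorZ (c : R) xi x : X (c *: xi) x = c *: X xi x.
Proof.
rewrite !generatorE; apply/matrixP => i k; rewrite !mxE /chart_generator.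
rewrite (_ : (c *: xi, 0) = c *: (xi, 0) :> 'rV[R]_n * 'rV[R]_d)%type; last first.
  by congr pair; rewrite scaler0.
by rewrite linearZ mxE.
Qed.

Lemma generator_bounded xi (T : R) gamma : 0 <= T -> abs_continuous 0 T gamma ->
  exists2 K, 0 <= K & forall t, 0 <= t <= T -> mass_norm m (X xi (gamma t)) <= K.
Proof.
move=> T0 gAC.
have dX x : differentiable (fun x => mass_dot m (X xi x) (X xi x)) x.
  have XD i k : differentiable (fun x : conf => X xi x i k) x.
    apply: (@differentiable_comp _ _ _ _ (X xi) (fun M : conf => M i k)).
      exact: generator_diff.
    exact: differentiable_coord.
  rewrite (_ : (fun x => _) = \sum_(i < N) \sum_(k < d)
      (fun x => m i *: (X xi x i k * X xi x i k))); last first.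
    by apply/funext => y; rewrite mass_dotE fct_sumE; apply: eq_bigr => i _; rewrite fct_sumE.
  apply: differentiable_sum => i; apply: differentiable_sum => k.
  by apply: differentiableZ; exact: differentiableM.
have cX := clamped_differentiable_continuous T0 gAC dX.
have [c _ cmax] := EVT_max T0 (continuous_subspaceT cX).
exists (mass_norm m (X xi (clamped 0 T gamma c))); first exact: sqrtr_ge0.
move=> t tT; apply: ler_wsqrtr.
by have := cmax t; rewrite in_itv/= => /(_ tT); rewrite /clamped/= (clamp_id tT).
Qed.

(** The increment of the deformed curve is split into the displacement of gamma
    moved by an isometry, and a piece of an orbit, of speed at most K. *)
Lemma deformed_abs_continuous g xi (T : R) gamma : 0 <= T ->
  abs_continuous 0 T gamma ->
  abs_continuous 0 T (fun t => S g (S (ex (t *: xi)) (gamma t))).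
Proof.
move=> T0 gAC.
have [K K0 XK] := generator_bounded xi T0 gAC.
have [C C0 normC] := @norm_le_mass R N d m m_gt0.
have [C' C'0 massC] := @mass_le_norm R N d m m_gt0.
pose D := Num.sqrt C' + K.
have D0 : 0 <= D by rewrite addr_ge0// sqrtr_ge0.
apply: (@abs_continuous_le_increment _ _ _ _ _ (C * D) gamma) => //.
  by rewrite mulr_ge0// ltW.
move=> s t s0 st tT.
apply: le_trans (normC _) _; rewrite -mulrA ler_pM2l//.
apply: le_trans (diag_act_isometry _ _ _) _.
rewrite (_ : _ - _ = (S (ex (t *: xi)) (gamma t) - S (ex (t *: xi)) (gamma s)) +
  (S (ex (t *: xi)) (gamma s) - S (ex (s *: xi)) (gamma s))); last first.
  by rewrite addrA subrK.
apply: (@le_trans _ _ (mass_norm m (gamma t - gamma s) + mass_norm m (X xi (gamma s)) * (t - s))).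
  apply: le_trans (mass_norm_triangle _ _ _) _ => //.
  apply: lerD; first exact: diag_act_isometry.
  exact: flow_speed.
rewrite [leRHS]mulrDr [leLHS]addrC; apply: lerD.
  apply: ler_wpM2r; rewrite ?subr_ge0//; apply: (@le_trans _ _ K).
    by apply: XK; rewrite s0 (le_trans st).
  by rewrite lerDr sqrtr_ge0.
apply: (@le_trans _ _ (Num.sqrt C' * `|gamma t - gamma s|)).
  rewrite /mass_norm (le_trans (ler_wsqrtr (massC _)))// sqrtrM ?(ltW C'0)//.
  by rewrite sqrtr_sqr normr_id.
by apply: ler_wpM2r => //; rewrite lerDl.
Qed.

Lemma generator_clamped_continuous xi (T : R) gamma i k : 0 <= T ->
  abs_continuous 0 T gamma -> continuous (fun t => X xi (clamped 0 T gamma t) i k).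
Proof.
move=> T0 gAC.
apply: (@clamped_differentiable_continuous _ _ _ _ _ gamma (fun x => X xi x i k)) => // x.
apply: (@differentiable_comp _ _ _ _ (X xi) (fun M : conf => M i k)).
  exact: generator_diff.
exact: differentiable_coord.
Qed.

Lemma generator_clamped_measurable xi (T : R) gamma i k : 0 <= T ->
  abs_continuous 0 T gamma ->
  measurable_fun setT (fun t => X xi (clamped 0 T gamma t) i k).
Proof.
by move=> T0 gAC; apply: continuous_measurable_fun; exact: generator_clamped_continuous.
Qed.

(** The deformation beta of the reversed curve joins S_g (gamma T) to
    S_g S_(exp (T xi)) (gamma 0), so its action bounds the increment of u.
    Invariance of L undoes the symmetry in the integrand, where the velocity
    becomes X_xi - p at time T - t; L is even in the velocity. *)
Theorem deformed_action (u : conf -> R) g xi (T : R) gamma p : dominated m u ->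
  0 < T -> abs_continuous 0 T gamma -> is_velocity 0 T gamma p ->
  ((u (S g (S (ex (T *: xi)) (gamma 0))) - u (S g (gamma T)))%:E <=
   \int[mu]_(t in `[0%R, T])
     lagrangian m (clamped 0 T gamma t) (p t - X xi (clamped 0 T gamma t)))%E.
Proof.
move=> domu T0 gAC pv.
pose beta t := S g (S (ex (t *: xi)) (gamma (T - t))).
have betaAC : abs_continuous 0 T beta.
  exact: (deformed_abs_continuous g xi (ltW T0)
    (abs_continuous_reverse gAC)).
have beta0 : beta 0 = S g (gamma T).
  by rewrite /beta scale0r exp0 diag_act1 subr0.
have betaT : beta T = S g (S (ex (T *: xi)) (gamma 0)) by rewrite /beta subrr.
pose F t := lagrangian m (clamped 0 T gamma t) (p t - X xi (clamped 0 T gamma t)).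
have F0 t : (0 <= F t)%E by exact: lagrangian_ge0.
have mF : measurable_fun setT F.
  apply: measurable_lagrangian => // i k; first exact: clamped_measurable (ltW T0) gAC.
  under eq_fun do rewrite !mxE.
  apply: measurable_funB; first exact: velocity_measurable pv.
  exact: generator_clamped_measurable (ltW T0) gAC.
rewrite -betaT -beta0.
apply: le_trans (domu (beta 0) (beta T)) _.
apply: (@le_trans _ _ (action m 0 T beta)).
  by apply: ereal_inf_lbound; exists 0, T, beta.
rewrite (@action_ae _ _ _ _ m_gt0 _ _ (fun t => F (T - t))).
- have E := @integral_reflection R T F mF F0.
  by rewrite le_eqVlt; apply/orP; left; apply/eqP; exact: E.
- exact: measurableT_comp mF (measurable_reflection T).
- by move=> t; exact: F0.
- case: pv => _ _ /ae_reflection - /(_ T); apply: filterS.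
    exact: (ae_filter_ringOfSetsType mu).
  move=> t D t0 tT.
  have {}D : is_derive (T - t) 1 gamma (p (T - t)) by apply: D; lra.
  have Dr : is_derive t 1 (fun s => gamma (T - s)) (- p (T - t)).
    have [/derivable1_diffP Dg pE] := D.
    have := is_derive_chain (is_deriveB (is_derive_cst T t 1) (is_derive_id t 1)) Dg.
    by rewrite /= sub0r linearN -deriveE// pE.
  have := deformation_derive g xi Dr.
  move=> [_ Db]; rewrite derive1E Db /beta -diag_actM.
  rewrite hL /F /clamped/= clamp_id; last by apply/andP; split; lra.
  by rewrite -[LHS]lagrangianN// opprD opprK [- _ + _]addrC.
Qed.

Section FirstVariation.
Variables (u : conf -> R) (gamma : R -> conf) (T : R) (p : R -> conf).
Hypotheses (domu : dominated m u) (calu : calibrates m u gamma) (T0 : 0 < T)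
  (pv : is_velocity 0 T gamma p).
Local Notation cg := (clamped 0 T gamma).
Local Notation D := (`[0%R, T]%classic : set R).

Let gAC : abs_continuous 0 T gamma.
Proof. by case: calu => + _; apply. Qed.

Let K t := lagrangian m (cg t) (p t).

Let mp i k : measurable_fun setT (fun t => p t i k).
Proof. exact: velocity_measurable pv. Qed.

Let mg i k : measurable_fun setT (fun t => cg t i k).
Proof. exact: clamped_measurable (ltW T0) gAC. Qed.

Let mX xi i k : measurable_fun setT (fun t => X xi (cg t) i k).
Proof. exact: (generator_clamped_measurable xi i k (ltW T0) gAC). Qed.

Lemma calibrated_action : (\int[mu]_(t in D) K t)%E = (u (gamma 0) - u (gamma T))%:E.
Proof.
by rewrite -(action_velocity m_gt0 T0 gAC pv); case: calu => _ /(_ T T0) ->.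
Qed.

Let mK : measurable_fun setT K.
Proof. exact: measurable_lagrangian. Qed.

Lemma lagrangian_integrable : mu.-integrable D K.
Proof.
apply/integrableP; split; first exact: measurable_funS mK.
rewrite (_ : (\int[mu]_(t in D) `|K t|)%E = (\int[mu]_(t in D) K t)%E).
  by rewrite calibrated_action ltry.
by apply: eq_integral => t _; rewrite gee0_abs// lagrangian_ge0.
Qed.

(** The action of a calibrating curve is the increment of u, hence finite, and it
    bounds the energy. *)
Lemma kinetic_integrable : mu.-integrable D (fun t => (mass_dot m (p t) (p t))%:E).
Proof.
have h : mu.-integrable D (fun t => (2 : R)%:E * K t)%E.
  by apply: integrableZl => //; exact: lagrangian_integrable.
apply: le_integrable h => //.
  by apply: measurable_funTS; apply/measurable_EFinP; exact: measurable_mass_dot.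
move=> t _; rewrite gee0_abs ?lee_fin ?mass_dot_ge0//.
rewrite gee0_abs; last by rewrite mule_ge0// lagrangian_ge0.
rewrite /K lagrangianE// ge0_muleDr ?potential_ge0//; last first.
  by rewrite lee_fin mulr_ge0// mass_dot_ge0.
rewrite -EFinM mulrA mulfV ?mul1r//; apply: leeDl.
by rewrite mule_ge0// potential_ge0.
Qed.

Lemma generator_integrable xi :
  mu.-integrable D (fun t => (mass_dot m (X xi (cg t)) (X xi (cg t)))%:E).
Proof.
have [C C0 XC] := generator_bounded xi (ltW T0) gAC.
have h : mu.-integrable D (fun=> (C ^+ 2)%:E).
  apply/integrableP; split; first exact: measurable_cst.
  rewrite integral_cst//= lebesgue_measure_itv/= lte_fin T0 -EFinB -EFinM.
  exact: ltry.
apply: le_integrable h => //.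
  by apply: measurable_funTS; apply/measurable_EFinP; exact: measurable_mass_dot.
move=> t; rewrite /= in_itv/= => tT.
rewrite lee_fin !ger0_norm ?sqr_ge0 ?mass_dot_ge0//.
rewrite -mass_norm_sqr// ler_sqr ?nnegrE ?sqrtr_ge0//.
by rewrite /clamped/= clamp_id//; exact: XC.
Qed.

(** By the inequality 2 |p . X| <= |p|^2 + |X|^2. *)
Lemma momentum_integrable xi :
  mu.-integrable D (fun t => (mass_dot m (p t) (X xi (cg t)))%:E).
Proof.
have h : mu.-integrable D (fun t => (mass_dot m (p t) (p t))%:E +
    (mass_dot m (X xi (cg t)) (X xi (cg t)))%:E)%E.
  by apply: integrableD => //; [exact: kinetic_integrable|exact: generator_integrable].
apply: le_integrable h => //.
  by apply: measurable_funTS; apply/measurable_EFinP; exact: measurable_mass_dot.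
move=> t _ /=; rewrite ?lee_fin [leRHS]ger0_norm; last first.
  by rewrite addr_ge0// mass_dot_ge0.
have := mass_dot_ge0 m_gt0 (p t - X xi (cg t)).
have := mass_dot_ge0 m_gt0 (p t + X xi (cg t)).
rewrite mass_dotB mass_dotDl !mass_dotDr (mass_dotC m (X xi (cg t)) (p t)).
have := mass_dot_ge0 m_gt0 (p t); have := mass_dot_ge0 m_gt0 (X xi (cg t)).
by move=> *; rewrite ler_norml; lra.
Qed.

(** The square in the Lagrangian of [deformed_action] for e xi is expanded; the
    term of degree 0 in e is the action of gamma, known by calibration. *)
Theorem first_variation g xi (e : R) :
  u (S g (S (ex (T *: (e *: xi))) (gamma 0))) - u (S g (gamma T)) <=
  u (gamma 0) - u (gamma T)
  - e * \int[mu]_(t in D) mass_dot m (p t) (X xi (cg t))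
  + e ^+ 2 / 2 * \int[mu]_(t in D) mass_dot m (X xi (cg t)) (X xi (cg t)).
Proof.
rewrite -lee_fin.
apply: le_trans (deformed_action g (e *: xi) domu T0 gAC pv) _.
pose I t := mass_dot m (p t) (X xi (cg t)).
pose Q t := mass_dot m (X xi (cg t)) (X xi (cg t)).
have LE t : lagrangian m (cg t) (p t - X (e *: xi) (cg t)) =
    (K t + ((- e * I t) + (e ^+ 2 / 2 * Q t))%:E)%E.
  rewrite /K !lagrangianE// (generatorZ).
  rewrite mass_dotB !mass_dotZl !mass_dotZr -/(I t) -/(Q t).
  by rewrite addeAC -EFinD; congr (_%:E + _)%E; rewrite expr2; lra.
have iI : mu.-integrable D (fun t => (I t)%:E) by exact: momentum_integrable.
have iQ : mu.-integrable D (fun t => (Q t)%:E) by exact: generator_integrable.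
have iK : mu.-integrable D K by exact: lagrangian_integrable.
have iI' : mu.-integrable D (fun t => (- e * I t)%:E).
  have h : mu.-integrable D (fun t => (- e)%:E * (I t)%:E)%E by apply: integrableZl.
  exact: h.
have iQ' : mu.-integrable D (fun t => (e ^+ 2 / 2 * Q t)%:E).
  have h : mu.-integrable D (fun t => (e ^+ 2 / 2)%:E * (Q t)%:E)%E by apply: integrableZl.
  exact: h.
have iIQ : mu.-integrable D (fun t => (- e * I t + e ^+ 2 / 2 * Q t)%:E).
  have h : mu.-integrable D (fun t => (- e * I t)%:E + (e ^+ 2 / 2 * Q t)%:E)%E.
    exact: integrableD.
  exact: h.
rewrite [leLHS](_ : _ = (\int[mu]_(t in D) (K t + (- e * I t + e ^+ 2 / 2 * Q t)%:E))%E); last first.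
  by apply: eq_integral => t _; exact: LE.
rewrite (integralD _ iK iIQ)// calibrated_action.
have IQE : (\int[mu]_(t in D) (- e * I t + e ^+ 2 / 2 * Q t)%:E)%E =
    (- e * \int[mu]_(t in D) I t + e ^+ 2 / 2 * \int[mu]_(t in D) Q t)%:E.
  rewrite -RintegralZl// -RintegralZl// -RintegralD//.
  by rewrite fineK// integrable_fin_num.
by rewrite IQE -EFinD lee_fin -!/(I _) -!/(Q _) mulNr addrA.
Qed.

End FirstVariation.

(** * Invariance implies vanishing momentum *)

Section Forward.
Variables (u : conf -> R) (gamma : R -> conf).
Hypotheses (domu : dominated m u) (calu : calibrates m u gamma).
Hypothesis invu : invariant_fun act u.

(** By invariance the first variation bounds e times this integral by a multiple
    of e^2, for e of either sign. *)
Lemma mean_momentum_zero xi (T : R) p : 0 < T -> is_velocity 0 T gamma p ->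
  \int[mu]_(t in `[0, T]) mass_dot m (p t) (X xi (clamped 0 T gamma t)) = 0.
Proof.
move=> T0 pv; apply: (@linear_le_quadratic _ _ (\int[mu]_(t in `[0, T])
  mass_dot m (X xi (clamped 0 T gamma t)) (X xi (clamped 0 T gamma t)))) => e.
have := first_variation domu calu T0 pv 1%g xi e.
rewrite 2!diag_act1 invu.
move: (Rintegral _ _ _) (Rintegral _ _ _) => I Q.
by move: (u (gamma 0) - u (gamma T)) (e ^+ 2 / 2 * Q) (e * I) => a b c; lra.
Qed.

Lemma is_velocity_restrict (T T' : R) p : T' <= T -> is_velocity 0 T gamma p ->
  is_velocity 0 T' gamma p.
Proof.
move=> TT' [pint pE pD]; split => //.
  by move=> i k s t s0 st tT'; apply: pE => //; exact: le_trans TT'.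
move: pD; apply: filterS; first exact: (ae_filter_ringOfSetsType mu).
by move=> t D t0 tT'; apply: D => //; exact: lt_le_trans TT'.
Qed.

Lemma mean_momentum_zero_oc xi (T s t : R) p : is_velocity 0 T gamma p ->
  0 < s -> s <= t -> t <= T ->
  \int[mu]_(r in `]s, t]) mass_dot m (p r) (X xi (clamped 0 T gamma r)) = 0.
Proof.
move=> pv s0 st tT; have T0 : 0 < T by rewrite (lt_le_trans s0)// (le_trans st).
pose f r := mass_dot m (p r) (X xi (clamped 0 T gamma r)).
have zero r : 0 < r -> r <= T -> \int[mu]_(q in `[0, r]) f q = 0.
  move=> r0 rT; rewrite -[RHS](mean_momentum_zero xi r0 (is_velocity_restrict rT pv)).
  apply: eq_Rintegral => q; rewrite inE/= in_itv/= => /andP[q0 qr].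
  by rewrite /f /clamped/= !clamp_id ?q0 ?qr ?(le_trans qr).
have fint : mu.-integrable `[0, t] (EFin \o f).
  have := momentum_integrable calu T0 pv xi.
  by apply: integrableS => //; apply: subset_itvl; rewrite bnd_simp.
rewrite -(Rintegral_itvB fint) ?bnd_simp ?(ltW s0)//.
by rewrite !zero// ?subrr// ?(lt_le_trans s0)// (le_trans st).
Qed.

(** The increment of gamma is the integral of p on ]t0, t]. Subtracting the
    vanishing integral of p . X (gamma s) leaves the integral of
    p . (X (gamma t0) - X (gamma s)), at most M (t - t0) times that of |p|, and
    2 |p| <= delta |p|^2 + 1 / delta. The energy is taken on all of [0, T], so
    that it does not depend on t. *)
Lemma increment_bound xi (T t0 t M delta : R) p : is_velocity 0 T gamma p ->
  0 < t0 -> t0 < t -> t <= T -> 0 < delta -> 0 <= M ->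
  (forall s, t0 < s -> s <= t ->
     mass_norm m (X xi (gamma t0) - X xi (gamma s)) <= M * (t - t0)) ->
  `|mass_dot m (gamma t - gamma t0) (X xi (gamma t0))| <=
    M * (t - t0) / 2 * (delta * \int[mu]_(s in `[0, T]) mass_dot m (p s) (p s)
       + (t - t0) / delta).
Proof.
move=> pv t00 t0t tT delta0 M0 XM.
have T0 : 0 < T by rewrite (lt_le_trans _ tT)// (lt_trans t00).
pose X0 := X xi (gamma t0); pose Y s := X xi (clamped 0 T gamma s).
have JD : `]t0, t]%classic `<=` `[0, T]%classic.
  by move=> s; rewrite /= !in_itv/= => /andP[/ltW s1 s2]; rewrite (le_trans (ltW t00))//= (le_trans s2).
have i1 : mu.-integrable `]t0, t] (fun s => (mass_dot m (p s) X0)%:E).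
  by apply: integrableS (integrable_velocity_dot m X0 pv).
have i2 : mu.-integrable `]t0, t] (fun s => (mass_dot m (p s) (Y s))%:E).
  by apply: integrableS (momentum_integrable calu T0 pv xi).
have i3 : mu.-integrable `]t0, t] (fun s => (mass_dot m (p s) (p s))%:E).
  by apply: integrableS (kinetic_integrable calu T0 pv).
have i12 : mu.-integrable `]t0, t] (fun s => (mass_dot m (p s) X0 - mass_dot m (p s) (Y s))%:E).
  have h : mu.-integrable `]t0, t] (fun s => (mass_dot m (p s) X0)%:E - (mass_dot m (p s) (Y s))%:E)%E.
    by apply: (integrableB _ i1 i2).
  exact: h.
pose c := M * (t - t0) / 2.
have c0 : 0 <= c by rewrite divr_ge0// mulr_ge0// subr_ge0 ltW.
rewrite -(integral_velocity_dot m X0 pv (ltW t00) (ltW t0t) tT).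
rewrite -[X in `|X|]subr0 -[X in `|_ - X|](mean_momentum_zero_oc xi pv t00 (ltW t0t) tT).
rewrite -(RintegralB _ i1 i2); last by [].
apply: le_trans (le_normr_Rintegral _ i12) _; first by [].
pose B s := c * (delta * mass_dot m (p s) (p s) + delta^-1).
have iB : mu.-integrable `]t0, t] (EFin \o B).
  have h1 : mu.-integrable `]t0, t] (fun s => delta%:E * (mass_dot m (p s) (p s))%:E)%E.
    by apply: (integrableZl _ _ i3).
  have h2 : mu.-integrable `]t0, t] (fun=> delta^-1%:E).
    apply/integrableP; split; first exact: measurable_cst.
    rewrite integral_cst//= lebesgue_measure_itv/= lte_fin t0t -EFinB -EFinM.
    exact: ltry.
  have h3 : mu.-integrable `]t0, t] (fun s => c%:E * (delta%:E * (mass_dot m (p s) (p s))%:E + delta^-1%:E))%E.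
    by apply: (integrableZl _ _ (integrableD _ h1 h2)).
  exact: h3.
apply: (@le_trans _ _ (\int[mu]_(s in `]t0, t]) B s)).
  apply: le_Rintegral; first by [].
  - have h := integrable_norm i12; exact: h.
  - exact: iB.
  move=> s ts; have := JD _ ts; move: ts; rewrite /= !in_itv/= => /andP[ts st] /andP[s0 sT].
  have -> : mass_dot m (p s) X0 - mass_dot m (p s) (Y s) = mass_dot m (p s) (X0 - Y s).
    by rewrite mass_dotDr mass_dotNr.
  apply: le_trans (normr_mass_dot m_gt0 _ _) _.
  have YE : Y s = X xi (gamma s) by rewrite /Y /clamped/= clamp_id// s0 sT.
  apply: (@le_trans _ _ (mass_norm m (p s) * (M * (t - t0)))).
    by apply: ler_wpM2l; [exact: sqrtr_ge0|rewrite YE; exact: XM].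
  rewrite /B -mass_norm_sqr// /c -[leLHS]mulrC -[leRHS]mulrA.
  apply: ler_wpM2l; first by rewrite mulr_ge0// subr_ge0 ltW.
  have := sqr_ge0 (mass_norm m (p s) - delta^-1).
  rewrite -(pmulr_rge0 _ delta0) sqrrB mulrDr mulrBr.
  have dd : delta * delta^-1 = 1 by rewrite mulfV// gt_eqF.
  have -> : delta * delta^-1 ^+ 2 = delta^-1 by rewrite expr2 mulrA dd mul1r.
  have -> : delta * (mass_norm m (p s) / delta *+ 2) = mass_norm m (p s) *+ 2.
    by rewrite mulrnAr mulrCA dd mulr1.
  rewrite mulr2n; move: (delta * mass_norm m (p s) ^+ 2) => a.
  move: (mass_norm m (p s)) (delta^-1) => b c'; lra.
have ipp : mu.-integrable `[0, T] (fun s => (mass_dot m (p s) (p s))%:E).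
  exact: (kinetic_integrable calu T0 pv).
have -> : \int[mu]_(s in `]t0, t]) B s =
    c * (delta * \int[mu]_(s in `]t0, t]) mass_dot m (p s) (p s) + (t - t0) / delta).
  have h1 : mu.-integrable `]t0, t] (EFin \o (fun s => delta * mass_dot m (p s) (p s))).
    by apply: (integrableZl _ _ i3).
  have h2 : mu.-integrable `]t0, t] (EFin \o (fun=> delta^-1)).
    apply/integrableP; split; first exact: measurable_cst.
    rewrite integral_cst//= lebesgue_measure_itv/= lte_fin t0t -EFinB -EFinM.
    exact: ltry.
  have h3 : mu.-integrable `]t0, t] (EFin \o (fun s => delta * mass_dot m (p s) (p s) + delta^-1)).
    by apply: (integrableD _ h1 h2).
  rewrite (RintegralZl _ _ h3); last by [].
  rewrite (RintegralD _ h1 h2); last by [].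
  rewrite (RintegralZl _ _ i3); last by [].
  rewrite Rintegral_cst; last by [].
  by rewrite /= lebesgue_measure_itv/= lte_fin t0t/= [delta^-1 * _]mulrC.
apply: ler_wpM2l => //; rewrite lerD2r; apply: ler_wpM2l; first exact: ltW.
apply: fine_le; [exact: integrable_fin_num|exact: integrable_fin_num|].
apply: ge0_subset_integral => //.
- by apply: measurable_funS (measurable_int _ ipp).
- by move=> s _; rewrite lee_fin mass_dot_ge0.
Qed.

(** X_xi gamma is Lipschitz at t0, so [increment_bound] applies at
    t = t0 + tau, with delta small but fixed and then tau small compared with
    delta: the product of the increment with X_xi (gamma t0) is o (tau), while
    it is also tau times the momentum, up to o (tau). *)
Theorem calibrated_momentum_zero xi (t0 : R) : 0 < t0 -> derivable gamma t0 1 ->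
  mass_dot m (derive1 gamma t0) (X xi (gamma t0)) = 0.
Proof.
move=> t00 dg; pose T := t0 + 1.
have T0 : 0 < T by rewrite addr_gt0.
have gAC : abs_continuous 0 T gamma by case: calu => + _; exact.
have [p pv] := velocity_exists (ltW T0) gAC.
set v := derive1 gamma t0; set X0 := X xi (gamma t0); set w := mass_dot m v X0.
have Dg : is_derive t0 1 gamma v by apply: DeriveDef; [exact: dg|rewrite /v derive1E].
have DY := is_derive_chain Dg (generator_diff xi (gamma t0)).
have [L0 [r1 /= r10 Lip]] : exists L, exists2 r : R, 0 < r & forall s, `|t0 - s| < r ->
    `|X xi (gamma s) - X0| <= L * `|s - t0|.
  have /nbhs_ballP[r /= r0 rP] := is_derive_lipschitz DY.
  by eexists; exists r => // s rs; exact: (rP s).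
have DG := is_derive_mass_dot m X0 Dg.
have [C' C'0 massC] := @mass_le_norm R N d m m_gt0.
pose L := Num.max L0 0; pose M := Num.sqrt C' * L.
have M0 : 0 <= M by rewrite mulr_ge0 ?sqrtr_ge0// le_max lexx orbT.
pose E := \int[mu]_(s in `[0, T]) mass_dot m (p s) (p s).
have E0 : 0 <= E by apply: Rintegral_ge0 => s _; exact: mass_dot_ge0.
apply/eqP; rewrite -normr_le0; apply/ler_addgt0Pr => e e0; rewrite add0r.
have e4 : 0 < e / 4 by rewrite divr_gt0.
have [r2 /= r20 Diff] : exists2 r : R, 0 < r & forall s, `|t0 - s| < r ->
    `|mass_dot m X0 (gamma s) - mass_dot m X0 (gamma t0) - (s - t0) * mass_dot m X0 v| <=
    e / 4 * `|s - t0|.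
  by have /nbhs_ballP[r /= r0 rP] := is_derive_near DG e4; exists r => // s rs; exact: (rP s).
have ME : 0 < M * E + 1 by rewrite ltr_wpDl// mulr_ge0.
(* delta and r3 make the two terms of [increment_bound] at most e / 4 * tau *)
pose delta := e / 2 / (M * E + 1).
have delta0 : 0 < delta by rewrite !divr_gt0.
have deltaE : delta * (M * E + 1) = e / 2 by rewrite /delta mulfVK// gt_eqF.
pose r3 := delta * e / 2 / (M + 1).
have M1 : 0 < M + 1 by rewrite ltr_wpDl.
have r30 : 0 < r3 by rewrite !divr_gt0// mulr_gt0.
have r3E : r3 / delta * (M + 1) = e / 2.
  by rewrite /r3; field; rewrite !gt_eqF.
pose tau := Num.min (Num.min (r1 / 2) (r2 / 2)) (Num.min 1 r3).
have tau0 : 0 < tau by rewrite !lt_min; apply/andP; split; apply/andP; split; rewrite ?ltr01 ?r30//; lra.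
have [tr1 tr2 t1 tr3] : [/\ tau < r1, tau < r2, tau <= 1 & tau <= r3].
  split; rewrite /tau.
  - by apply: (@le_lt_trans _ _ (r1 / 2)); rewrite ?ge_min ?lexx//; lra.
  - by apply: (@le_lt_trans _ _ (r2 / 2)); rewrite ?ge_min ?lexx ?orbT//; lra.
  - by rewrite !ge_min lexx !orbT.
  - by rewrite !ge_min lexx !orbT.
move: tau tau0 tr1 tr2 t1 tr3 => tau tau0 tr1 tr2 t1 tr3.
pose t := t0 + tau.
have tt0 : t - t0 = tau by rewrite /t addrC addKr.
have XM s : t0 < s -> s <= t -> mass_norm m (X0 - X xi (gamma s)) <= M * (t - t0).
  move=> t0s st; rewrite tt0.
  have stau : `|s - t0| <= tau by rewrite ger0_norm; rewrite /t in st; lra.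
  have : `|X xi (gamma s) - X0| <= L * tau.
    have := Lip s; rewrite distrC => /(_ (le_lt_trans stau tr1)) h.
    apply: le_trans h _; apply: (@le_trans _ _ (L * `|s - t0|)).
      by apply: ler_wpM2r => //; rewrite le_max lexx.
    by apply: ler_wpM2l => //; rewrite le_max lexx orbT.
  move=> h; rewrite -mulrA /mass_norm (le_trans (ler_wsqrtr (massC _)))//.
  rewrite sqrtrM ?(ltW C'0)// sqrtr_sqr normr_id; apply: ler_wpM2l; first exact: sqrtr_ge0.
  by rewrite distrC.
have t0t : t0 < t by rewrite ltrDl.
have tT : t <= T by rewrite lerD2l.
have := increment_bound pv t00 t0t tT delta0 M0 XM.
rewrite tt0 -/E -/X0 mass_dotDl mass_dotNl.
have : `|t0 - t| < r2 by rewrite distrC tt0 gtr0_norm.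
move/Diff; rewrite tt0 !(mass_dotC m X0) -/w (gtr0_norm tau0).
set dG := mass_dot m (gamma t) X0 - mass_dot m (gamma t0) X0 => h1 h2.
rewrite -(ler_pM2l tau0) -{1}(gtr0_norm tau0) -normrM.
have h3 : `|tau * w| <= `|dG - tau * w| + `|dG|.
  by rewrite -{1}[tau * w](subKr dG) opprB addrC (le_trans (ler_normD _ _))// distrC addrC.
apply: le_trans h3 _; apply: le_trans (lerD h1 h2) _.
have -> : M * tau / 2 * (delta * E + tau / delta) =
    tau * (delta * (M * E) / 2 + (tau / delta * M) / 2) by lra.
rewrite [e / 4 * tau]mulrC -mulrDr; apply: ler_wpM2l; first exact: ltW.
have h4 : delta * (M * E) <= e / 2.
  by rewrite -deltaE mulrDr mulr1 lerDl ltW.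
have h5 : tau / delta * M <= e / 2.
  rewrite -r3E; apply: ler_pM => //; first by rewrite divr_ge0// ltW.
    by rewrite ler_pM2r ?invr_gt0.
  by rewrite lerDl.
move: h4 h5; move: (delta * _) (tau / delta * M) => a b; lra.
Qed.

End Forward.

(** * Vanishing momentum implies invariance *)

Section Backward.
Variable (u : conf -> R).
Hypothesis (kamu : weak_KAM m u).
Hypothesis momentum0 : forall gamma xi (t : R), calibrates m u gamma -> 0 < t ->
  mass_dot m (derive1 gamma t) (X xi (gamma t)) = 0.

Let domu : dominated m u. Proof. by case: kamu. Qed.

(** The first variation on [0, 1] with g = 1, for a calibrating curve from x: its
    linear term is zero since p is the velocity almost everywhere. *)
Lemma orbit_quadratic x xi : exists2 C, 0 <= C &
  forall e, u (S (ex (e *: xi)) x) - u x <= C * e ^+ 2.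
Proof.
have [gamma gx calu] := kamu.2 x.
have gAC : abs_continuous 0 1 gamma by case: calu => + _; apply.
have [p pv] := velocity_exists ler01 gAC.
pose Q := \int[mu]_(t in `[0, 1]) mass_dot m (X xi (clamped 0 1 gamma t)) (X xi (clamped 0 1 gamma t)).
exists (`|Q| / 2); first by rewrite divr_ge0.
move=> e.
have := first_variation domu calu ltr01 pv 1%g xi e.
rewrite !diag_act1 -/Q scale1r gx.
rewrite (_ : \int[mu]_(t in `[0, 1]) mass_dot m (p t) (X xi (clamped 0 1 gamma t)) = 0).
  have : e ^+ 2 / 2 * Q <= e ^+ 2 / 2 * `|Q|.
    by rewrite ler_wpM2l ?ler_norm// divr_ge0// sqr_ge0.
  rewrite mulr0; move: Q => Q; move: (u (S _ x)) (u x) (u (gamma 1)) => a b c; lra.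
rewrite /Rintegral (_ : \int[mu]_(t in `[0%R, 1%R]) _ = 0)%E//.
have mI := momentum_integrable calu ltr01 pv xi.
rewrite -[RHS](integral0 mu `[0%R, 1%R]).
apply: ae_eq_integral => //; first exact: measurable_int mI.
have n0 (c : R) : {ae mu, forall t, t <> c}.
  exists [set c]; split => //; first exact: lebesgue_measure_set1.
  by move=> t /= /contrapT.
case: pv => _ _ pD.
move: pD (n0 0) (n0 1); apply: filterS3; first exact: (ae_filter_ringOfSetsType mu).
move=> t D /eqP t0 /eqP t1; rewrite /= in_itv/= => /andP[h0 h1].
have t0' : 0 < t by rewrite lt_neqAle h0 eq_sym t0.
have t1' : t < 1 by rewrite lt_neqAle h1 t1.
have [_ pE] := D t0' t1'; rewrite -pE.
rewrite -derive1E /clamped/= clamp_id ?h0 ?h1//.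
by rewrite momentum0.
Qed.

Lemma collision_free_diag_act g x : collision_free x -> collision_free (S g x).
Proof.
move=> xcf i j ij; rewrite !row_diag_act; apply: contra (xcf i j ij) => /eqP E.
apply/eqP; rewrite -[row i x](act1) -[row j x](act1) -(mulVg g).
by rewrite !actM E.
Qed.

(** Near time s the path P t = S_(param c (q t)) x is tangent to the orbit Q t of
    P s under a one-parameter subgroup. So u (P t) and u (Q t) differ by
    o (t - s) by the Lipschitz bound, and u (Q t) - u (P s) is O ((t - s)^2) from
    above by [orbit_quadratic]: the upper Dini derivative is at most 0. *)
Lemma path_constant x c (q : R -> 'rV[R]_n) (q' : R -> 'rV[R]_n) : collision_free x -> A c ->
  (forall s : R, 0 <= s <= 1 -> is_derive s 1 q (q' s)) ->
  (forall s : R, 0 <= s <= 1 -> \forall t \near s, (chart_map c @` dom c) (q t)) ->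
  u (S (param c (q 1)) x) = u (S (param c (q 0)) x).
Proof.
move=> xcf Ac Dq qc.
pose P s := S (param c (q s)) x.
apply: (@upper_dini_cst _ (fun s => u (P s))).
- move=> s s01.
  have [zeta D] := diag_path_velocity Ac (Dq s s01) (qc s s01).
  have [K [r [K0 r0 lip]]] := dominated_lipschitz m_gt0 domu
    (collision_free_diag_act (param c (q s)) xcf).
  have Pc : P t @[t --> s] --> P s.
    have Pd : differentiable P s by apply/derivable1_diffP; have [] := D x.
    exact: differentiable_continuous Pd.
  apply/cvgrPdist_le => e e0.
  have K1 : 0 < K + 1 by rewrite ltr_wpDl.
  have eK : 0 < e / (K + 1) by rewrite divr_gt0.
  near=> t.
  have tr : `|P s - P t| < r by near: t; move/cvgrPdist_lt : Pc; exact.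
  have te : `|P s - P t| < e / (K + 1) by near: t; move/cvgrPdist_lt : Pc; exact.
  have h1 := lip (P s) (P t); have h2 := lip (P t) (P s).
  rewrite !subrr !normr0 in h1 h2.
  have {}h1 := h1 r0 tr; have {}h2 := h2 tr r0.
  have h3 : K * `|P s - P t| <= e.
    rewrite (le_trans (ler_wpM2l K0 (ltW te)))//.
    rewrite mulrA ler_pdivrMr// mulrC ler_wpM2l ?(ltW e0)//; lra.
  rewrite [`|P t - P s|]distrC in h1.
  by rewrite ler_norml; move: (u (P s)) (u (P t)) (K * _) h1 h2 h3 => a b k; lra.
- move=> s e s01 e0.
  have [zeta D] := diag_path_velocity Ac (Dq s s01) (qc s s01).
  pose V := X zeta (P s).
  have [K [r [K0 r0 lip]]] := dominated_lipschitz m_gt0 domu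
    (collision_free_diag_act (param c (q s)) xcf).
  have [C C0 quad] := orbit_quadratic (P s) zeta.
  have D2 : is_derive s 1 (fun t => S (ex ((t - s) *: zeta)) (P s)) V.
    have := diag_exp_derive zeta (is_derive_cst (P s) s 1).
    by rewrite addr0.
  pose Q t := S (ex ((t - s) *: zeta)) (P s).
  have Qs : Q s = P s by rewrite /Q subrr scale0r exp0 diag_act1.
  have Pc : P t @[t --> s] --> P s.
    have Pd : differentiable P s by apply/derivable1_diffP; have [] := D x.
    exact: differentiable_continuous Pd.
  have Qc : Q t @[t --> s] --> P s.
    rewrite -[X in _ --> X]Qs.
    have Qd : differentiable Q s by apply/derivable1_diffP; have [] := D2.
    exact: differentiable_continuous Qd.
  have K1 : 0 < K + 1 by rewrite ltr_wpDl.
  have C1 : 0 < C + 1 by rewrite ltr_wpDl.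
  pose eta := e / 4 / (K + 1).
  have eta0 : 0 < eta by rewrite !divr_gt0.
  have etaK : eta * (K + 1) = e / 4 by rewrite /eta mulfVK// gt_eqF.
  have eC : 0 < e / 2 / (C + 1) by rewrite !divr_gt0.
  near=> t.
  have tr : `|P s - P t| < r by near: t; move/cvgrPdist_lt : Pc; exact.
  have qr : `|P s - Q t| < r by near: t; move/cvgrPdist_lt : Qc; exact.
  have dP : `|P t - P s - (t - s) *: V| <= eta * `|t - s|.
    by near: t; exact: is_derive_near (D x) eta0.
  have dQ : `|Q t - P s - (t - s) *: V| <= eta * `|t - s|.
    by rewrite -{1}Qs; near: t; exact: is_derive_near D2 eta0.
  have ts : `|t - s| <= e / 2 / (C + 1).
    by near: t; have := nbhsx_ballx s _ eC; apply: filterS => t /=; rewrite /ball/= distrC => /ltW.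
  have h1 := lip (Q t) (P t) qr tr.
  have h2 := quad (t - s).
  have PQ : `|P t - Q t| <= 2 * (eta * `|t - s|).
    rewrite (_ : P t - Q t = (P t - P s - (t - s) *: V) - (Q t - P s - (t - s) *: V)); last first.
      by apply/matrixP => i k; rewrite !mxE; lra.
    by rewrite (le_trans (ler_normB _ _))//; lra.
  have h3 : K * `|P t - Q t| <= e / 2 * `|t - s|.
    apply: (le_trans (ler_wpM2l K0 PQ)).
    have -> : e / 2 * `|t - s| = 2 * ((eta * (K + 1)) * `|t - s|) by rewrite etaK; lra.
    have : 0 <= eta * `|t - s| by rewrite mulr_ge0// ltW.
    by lra.
  have h4 : C * (t - s) ^+ 2 <= e / 2 * `|t - s|.
    rewrite -real_normK ?num_real// expr2 mulrA; apply: ler_wpM2r => //.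
    apply: (@le_trans _ _ ((C + 1) * `|t - s|)); first by rewrite ler_wpM2r// lerDl.
    by rewrite mulrC -ler_pdivlMr.
  rewrite -/(Q t) in h2.
  move: h1 h2 h3 h4; move: (u (P t)) (u (Q t)) (u (P s)) (C * _) (K * _) => a b c' k k'; lra.
Unshelve. all: by end_near. Qed.

Hypothesis hGconn : connected [set: G].

(** Elements near g are joined to g by a segment in a chart, inside a ball. *)
Lemma orbit_locally_constant x g : collision_free x ->
  nbhs g (fun h => u (S h x) = u (S g x)).
Proof.
move=> xcf; have [c Ac cg] := atlas_cover g.
have [domo imo _ cc _] := atlas_chart Ac.
pose z := chart_map c g.
have imz : nbhs z (chart_map c @` dom c) by apply: open_nbhs_nbhs; split => //; exists g.
have /nbhs_ballP[r /= r0 rP] := imz.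
have nd : nbhs g (dom c) by apply: open_nbhs_nbhs.
have nb : nbhs g (chart_map c @^-1` ball z r).
  by apply: (cc g cg); exact: nbhsx_ballx.
apply: filterS2 nd nb => h ch; rewrite /= -ball_normE /= => zh.
pose q (s : R) := z + s *: (chart_map c h - z).
have q0 : q 0 = z by rewrite /q scale0r addr0.
have q1 : q 1 = chart_map c h by rewrite /q scale1r addrC subrK.
have := @path_constant x c q
  (fun=> chart_map c h - z) xcf Ac.
rewrite q0 q1 !chartK//; apply.
  by move=> s _; exact: is_derive_line.
move=> s /andP[s0 s1].
have qc : q t @[t --> s] --> q s.
  have qd : differentiable q s.
    by apply/derivable1_diffP; have [] := is_derive_line z (chart_map c h - z) s.
  exact: differentiable_continuous qd.
apply: qc; apply: open_nbhs_nbhs; split => //; apply: rP.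
rewrite -ball_normE /= /q opprD addNKr normrN normrZ ger0_norm//.
apply: le_lt_trans zh; rewrite distrC -[leRHS]mul1r.
exact: ler_wpM2r.
Qed.

Lemma collision_free_invariant x g : collision_free x -> u (S g x) = u x.
Proof.
move=> xcf; pose B := [set h | u (S h x) = u x].
suff BT : B = setT by have : B g by rewrite BT.
apply: hGconn.
- by exists 1%g; rewrite /B/= diag_act1.
- exists B; last by rewrite setTI.
  rewrite openE => h Bh; rewrite /interior.
  by apply: filterS (orbit_locally_constant h xcf) => k kh; rewrite /B/= kh.
- exists B; last by rewrite setTI.
  rewrite -[B]setCK; apply: open_closedC; rewrite openE => h Bh; rewrite /interior.
  by apply: filterS (orbit_locally_constant h xcf) => k kh; rewrite /B/= kh.
Qed.

(** If gamma were in collision on ]0, 1], the potential, hence the action, would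
    be infinite. *)
Lemma calibrated_collision_free_time gamma : calibrates m u gamma ->
  exists2 t : R, 0 < t & collision_free (gamma t).
Proof.
move=> calu; apply: contrapT => H.
have gAC : abs_continuous 0 1 gamma by case: calu => + _; apply.
have [p pv] := velocity_exists ler01 gAC.
have Kinf t : t \in `]0, 1] -> lagrangian m (clamped 0 1 gamma t) (p t) = +oo%E.
  rewrite in_itv/= => /andP[t0 t1]; apply/eqP; rewrite -leye_eq leNgt; apply/negP => K.
  apply: H; exists t => //; apply: (potential_fin_collision_free m_gt0).
  apply: (le_lt_trans _ K); rewrite lagrangianE// /clamped/= clamp_id ?t1 ?(ltW t0)//.
  by apply: leeDr; rewrite lee_fin mulr_ge0// mass_dot_ge0.
have := calibrated_action calu ltr01 pv => KE.
have : (\int[mu]_(t in `]0%R, 1%R]) (+oo : \bar R) <= (u (gamma 0) - u (gamma 1))%:E)%E.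
  rewrite -KE; apply: (@le_trans _ _ (\int[mu]_(t in `]0%R, 1%R]) lagrangian m (clamped 0 1 gamma t) (p t))%E).
    by apply: ge0_le_integral_nonmeasurable => t; rewrite /= => tI; rewrite ?leey ?Kinf.
  apply: ge0_subset_integral => //.
  - have mKK : measurable_fun setT (fun t => lagrangian m (clamped 0 1 gamma t) (p t)).
      apply: measurable_lagrangian => // i k; first exact: clamped_measurable ler01 gAC.
      exact: velocity_measurable pv.
    exact: measurable_funS mKK.
  - by move=> t _; exact: lagrangian_ge0.
  - exact: subset_itv_oc_cc.
rewrite integral_cst//= lebesgue_measure_itv/= lte_fin ltr01 sube0 mule1.
by rewrite leye_eq.
Qed.

(** For e = 0 the first variation compares u at the ends of S_g gamma, and the
    end at time t is collision-free, where u is already known to be invariant. *)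
Lemma invariant_le g x : u (S g x) <= u x.
Proof.
have [gamma gx calu] := kamu.2 x.
have [t t0 tcf] := calibrated_collision_free_time calu.
have gAC : abs_continuous 0 t gamma by case: calu => + _; apply.
have [p pv] := velocity_exists (ltW t0) gAC.
have := first_variation kamu.1 calu t0 pv g 0 0.
rewrite !scaler0 exp0 diag_act1 (collision_free_invariant _ tcf) gx.
rewrite expr0n/= !mul0r subr0 addr0.
by rewrite lerD2r.
Qed.

Theorem momentum_zero_invariant : invariant_fun act u.
Proof.
move=> g x; apply/eqP; rewrite eq_le invariant_le /=.
have := invariant_le (g^-1)%g (S g x).
by rewrite -diag_actM mulVg diag_act1.
Qed.

End Backward.

End Symmetry.

(** * The equivalence *)

Theorem theorem2 (R : realType) (d N : nat) (hd : (2 <= d)%N)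
  (m : 'I_N -> R) (hm : forall i, 0 < m i)
  (n : nat) (G : pretopGroupType) (A : set (chart 'rV[R]_n G))
  (hG : is_lie_group A) (hGconn : connected [set: G])
  (act : G -> 'rV[R]_d -> 'rV[R]_d)
  (hact : is_smooth_action A act) (hproper : is_proper_action act)
  (hL : lagrangian_invariant m act) (hiso : lift_isometric m act)
  (c1 : chart 'rV[R]_n G) (hc1 : A c1) (hc1dom : dom c1 1%g)
  (expG : 'rV[R]_n -> G) (hexp : is_exponential A c1 expG)
  (mu : 'M[R]_(N, d) -> 'M[R]_(N, d) -> 'Hom('rV[R]_n, R^o))
  (hmu : is_momentum_map m act expG mu)
  (u : 'M[R]_(N, d) -> R) (hu : weak_KAM m u) :
  invariant_fun act u <->
  (forall gamma : R -> 'M[R]_(N, d), calibrates m u gamma ->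
     forall t : R, 0 < t -> mu (gamma t) (derive1 gamma t) = 0).
Proof.
split=> [invu gamma calu t t0|mu0].
- apply/lfunP => xi; rewrite hmu zero_lfunE.
  have [dg|/derive1_mx_not_derivable ->] := pselect (derivable gamma t 1); last exact: mass_dot0l.
  by apply: (calibrated_momentum_zero hG hact hc1 hc1dom hexp hm hL hiso (proj1 hu) calu invu).
- apply: (momentum_zero_invariant hG hact hc1 hc1dom hexp hm hL hiso hu _ hGconn).
  by move=> gamma xi t calu t0; rewrite -hmu mu0// zero_lfunE.
Qed.
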